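(* Let $G$ be an almost connected, locally compact Hausdorff topological group, and let $\alpha$ be the canonical action of $G$ on $B^{\infty}(G)$, the closed unit ball of $L^1(G)'$ with the weak-$^{\ast}$ topology, given by $\alpha(g,l)(f) = l(f \circ \lambda_G(g))$. Then $G$ is non-compact if and only if $\alpha$ has infinite topological entropy.
   Context: $\mathbb{N}$ is the set of natural numbers excluding $0$. A topological group $G$ is almost connected if the quotient $G/N(G)$ (with the quotient topology) is compact, where $N(G)$ is the connected component of the neutral element $e_G$ in $G$. A subset $S \subseteq G$ generates $G$ if $S$ contains $e_G$ and $G = \bigcup_{n\in\mathbb{N}} S^n$, where $S^n = \{s_1\cdots s_n \mid s_i \in S\}$; $G$ is compactly generated if it has a compact generating subset. It is a known fact that every almost connected, locally compact Hausdorff topological group is compactly generated. Fix $\mathbb{K} \in \{\mathbb{R},\mathbb{C}\}$ and a left Haar measure $\mu$ on $G$; $L^1(G)$ is the Banach space of ($\mathbb{K}$-valued) $\mu$-integrable functions (modulo null functions) with norm $\|\cdot\|_1$, and $L^1(G)'$ is its dual Banach space. $B^{\infty}(G)$ is the closed unit ball of $L^1(G)'$ endowed with the weak-$^{\ast}$ topology, i.e., the initial topology with respect to the maps $B^\infty(G)\to\mathbb{K}$, $l \mapsto l(f)$, $f \in L^1(G)$; it is a compact Hausdorff space. For $g \in G$, $\lambda_G(g)\colon G \to G$, $x \mapsto gx$. The map $\alpha \colon G \times B^{\infty}(G) \to B^{\infty}(G)$, $\alpha(g,l)(f) = l(f\circ\lambda_G(g))$ ($f \in L^1(G)$), is a continuous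 action of $G$ on $B^{\infty}(G)$. Entropy. Let $\alpha$ be a continuous action of a topological group $G$ on a compact Hausdorff space $X$. $\mathcal{C}(X)$ is the set of finite open coverings of $X$. For $\mathcal{U},\mathcal{V} \in \mathcal{C}(X)$ and $S \subseteq G$, write $\mathcal{U} \preceq_S^{\alpha} \mathcal{V}$ if for every $g \in S$ and every $V \in \mathcal{V}$ there is $U \in \mathcal{U}$ with $\alpha(g,V) = \{\alpha(g,x) \mid x\in V\} \subseteq U$. For compact $S \subseteq G$, $(S:\mathcal{U})_{\alpha} = \inf\{|\mathcal{V}| \mid \mathcal{V} \in \mathcal{C}(X),\ \mathcal{U} \preceq_S^{\alpha}\mathcal{V}\}$ (this is finite). For a compact generating subset $S$ of $G$, $\eta(\alpha,S,\mathcal{U}) = \limsup_{n\to\infty} \frac{\log_2 (S^n:\mathcal{U})_{\alpha}}{n}$ and $\eta(\alpha,S) = \sup\{\eta(\alpha,S,\mathcal{U}) \mid \mathcal{U}\in\mathcal{C}(X)\}$. For $G$ compactly generated and locally compact Hausdorff, $\alpha$ has infinite topological entropy if $\eta(\alpha,S) = \infty$ for some (equivalently, any) compact generating subset $S \subseteq G$. *)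

(* Defs.v *)
From HB Require Import structures.
From mathcomp Require Import all_boot all_order all_algebra finmap.
From mathcomp Require Import complex.
From mathcomp Require Import all_classical all_reals all_analysis.
From mathcomp Require Import measurable_realfun.

Set Implicit Arguments.
Unset Strict Implicit.
Unset Printing Implicit Defensive.

Import Order.TTheory GRing.Theory Num.Theory.
Import numFieldNormedType.Exports.

Local Open Scope classical_set_scope.
Local Open Scope ring_scope.

HB.structure Definition PreTopologicalGroup := {G of Topological G & Group G}.

HB.mixin Record PreTopologicalGroup_isTopologicalGroup G
    & PreTopologicalGroup G := {
  mulg_continuous : continuous (fun x : G * G => (x.1 * x.2)%g) ;
  invg_continuous : continuous (fun x : G => (x^-1)%g) ;
}.

#[short(type="topologicalGroupType")]
HB.structure Definition TopologicalGroup :=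
  {G of PreTopologicalGroup G & PreTopologicalGroup_isTopologicalGroup G}.

Section TopologicalGroups.
Variable G : topologicalGroupType.

Definition left_translation (g x : G) : G := (g * x)%g.

Definition identity_component : set G := connected_component [set: G] 1%g.

Definition left_coset (x : G) : set G :=
  left_translation x @` identity_component.

(* The elements of G/N(G), with N(G) the identity component, are classes of
   elements of [G] having the same left coset. *)
Definition same_coset (x y : G) : bool := `[< left_coset x = left_coset y >].

Let same_coset_refl : reflexive same_coset.
Proof. by move=> x; apply/asboolP. Qed.

Let same_coset_sym : symmetric same_coset.
Proof. by move=> x y; apply/asboolP/asboolP => ->. Qed.

Let same_coset_trans : transitive same_coset.
Proof. by move=> y x z /asboolP xy /asboolP yz; apply/asboolP; rewrite xy. Qed.

Canonical same_coset_equiv :=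
  EquivRel same_coset same_coset_refl same_coset_sym same_coset_trans.

Definition component_quotient : topologicalType :=
  quotient_topology {eq_quot same_coset}%qT.

Definition almost_connected : Prop := compact [set: component_quotient].

Definition set_expg (S : set G) (n : nat) : set G :=
  [set (\prod_(i < n) s i)%g | s in [set s : 'I_n -> G | forall i, S (s i)]].

Definition generates (S : set G) : Prop :=
  S 1%g /\ \bigcup_(n in [set n | (0 < n)%N]) set_expg S n = [set: G].

Definition compact_generating (S : set G) : Prop := compact S /\ generates S.

End TopologicalGroups.

(* None of the notions below needs [alpha] to be a continuous action on a
   compact Hausdorff space, hence no such structure is bundled with it. *)
Section Entropy.
Variables (R : realType) (G : topologicalGroupType) (X : topologicalType).
Variable alpha : G -> X -> X.
Local Open Scope ereal_scope.

Definition finite_open_covering (U : set (set X)) : Prop :=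
  [/\ finite_set U, U `<=` open & \bigcup_(A in U) A = [set: X]].

Definition refines_along (S : set G) (U V : set (set X)) : Prop :=
  forall g B, S g -> V B -> exists2 A, U A & alpha g @` B `<=` A.

Definition covering_number (S : set G) (U : set (set X)) : \bar R :=
  ereal_inf [set (#|` fset_set V|%fset%:R)%:E
            | V in [set V | finite_open_covering V /\ refines_along S U V]].

Definition log2e (x : \bar R) : \bar R := lne x * ((ln 2)^-1)%:E.

Definition covering_entropy (S : set G) (U : set (set X)) : \bar R :=
  limn_esup (fun n => log2e (covering_number (set_expg S n) U)
                      * (n%:R^-1)%:E).

Definition entropy (S : set G) : \bar R :=
  ereal_sup [set covering_entropy S U | U in finite_open_covering].

Definition infinite_topological_entropy : Prop :=
  exists2 S : set G, compact_generating S & entropy S = +oo.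

End Entropy.

Section BorelSets.
Variable G : topologicalGroupType.

(* The library's generated sigma-algebras live on pointed types; this alias
   carries the neutral element of the group as its point. *)
Definition pointed_group : Type := G.
HB.instance Definition _ := Choice.on pointed_group.
HB.instance Definition _ := isPointed.Build pointed_group (1%g : G).

Definition borelType : Type :=
  g_sigma_algebraType (@open G : set (set pointed_group)).
HB.instance Definition _ := Measurable.on borelType.

Lemma measurable_left_translation (g : G) :
  measurable_fun [set: borelType] (left_translation g : borelType -> borelType).
Proof.
apply: (@measurability _ _ borelType borelType _ _
  (@open G : set (set borelType))) => // _ [U oU <-].
apply: measurableI => //; apply: sub_sigma_algebra => /=.
have /continuousP : continuous (left_translation g).
  move=> x; apply: (@continuous_comp _ _ _ (fun x => (g, x))
    (fun x : G * G => (x.1 * x.2)%g)); last exact: mulg_continuous.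
  by apply: cvg_pair => /=; [exact: cvg_cst|exact: cvg_id].
exact.
Qed.

End BorelSets.

Section HaarMeasure.
Variables (R : realType) (G : topologicalGroupType).
Variable mu : {measure set (borelType G) -> \bar R}.
Local Open Scope ereal_scope.

(* A left Haar measure is a nonzero left invariant Radon measure on the Borel
   sets. In a Hausdorff group compact sets are closed, hence Borel. *)
Record left_haar_measure : Prop := LeftHaarMeasure {
  haar_neq0 : mu [set: G] != 0 ;
  haar_left_invariant : forall (g : G) (A : set (borelType G)),
    measurable A -> mu (left_translation g @` A) = mu A ;
  haar_compact_lty : forall K : set G, compact K -> mu K < +oo ;
  haar_outer_regular : forall A : set (borelType G), measurable A ->
    mu A = ereal_inf [set mu O | O in [set O : set G | open O /\ A `<=` O]] ;
  haar_inner_regular : forall O : set G, open O ->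
    mu O = ereal_sup [set mu K | K in [set K : set G | compact K /\ K `<=` O]]
}.

Lemma haar_pushforward (g : G) (A : set (borelType G)) : left_haar_measure ->
  measurable A -> pushforward mu (left_translation g : borelType G -> borelType G) A = mu A.
Proof.
move=> hmu mA; rewrite /pushforward -(haar_left_invariant hmu g^-1%g mA).
congr (mu _); apply/seteqP; split => [x gxA|_ [y yA <-]] /=.
  by exists (left_translation g x) => //; rewrite /left_translation mulKg.
by rewrite /left_translation mulVKg.
Qed.

End HaarMeasure.

Variant scalars := RealScalars | ComplexScalars.

Definition scalar_field (R : realType) (k : scalars) : numFieldType :=
  match k with
  | RealScalars => R
  | ComplexScalars => R[i]
  end.

Section Scalars.
Variables (R : realType) (k : scalars).
Local Notation K := (scalar_field R k).

Definition re_part : K -> R :=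
  match k return scalar_field R k -> R with
  | RealScalars => id
  | ComplexScalars => @complex.Re R
  end.

Definition im_part : K -> R :=
  match k return scalar_field R k -> R with
  | RealScalars => fun=> 0
  | ComplexScalars => @complex.Im R
  end.

(* The norm of [K] takes its (real) values in [K]. *)
Definition modulus (z : K) : R := re_part `|z|.

End Scalars.

Arguments re_part {R k}.
Arguments im_part {R k}.
Arguments modulus {R k}.

Section ScalarsTheory.
Variables (R : realType) (k : scalars).
Local Notation K := (scalar_field R k).
Implicit Types x y : K.

Lemma re_partD x y : re_part (x + y) = re_part x + re_part y.
Proof. by case: k x y => //= -[a b] [c d]. Qed.

Lemma im_partD x y : im_part (x + y) = im_part x + im_part y.
Proof. by case: k x y => /= [? ?|[a b] [c d]//]; rewrite addr0. Qed.

Lemma re_partM x y :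
  re_part (x * y) = re_part x * re_part y - im_part x * im_part y.
Proof. by case: k x y => /= [? ?|[a b] [c d]//]; rewrite mulr0 subr0. Qed.

Lemma im_partM x y :
  im_part (x * y) = re_part x * im_part y + im_part x * re_part y.
Proof. by case: k x y => /= [? ?|[a b] [c d]//]; rewrite mulr0 mul0r addr0. Qed.

Lemma re_part0 : re_part (0 : K) = 0.
Proof. by case: k. Qed.

Lemma im_part0 : im_part (0 : K) = 0.
Proof. by case: k. Qed.

Lemma modulusE x : modulus x = Num.sqrt (re_part x ^+ 2 + im_part x ^+ 2).
Proof.
case: k x => /= [x|[a b]]; rewrite /modulus /=.
  by rewrite expr0n addr0 sqrtr_sqr.
by [].
Qed.

End ScalarsTheory.

Section IntegrableFunctions.
Variables (R : realType) (k : scalars) (G : topologicalGroupType).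
Variable mu : {measure set (borelType G) -> \bar R}.
Local Notation K := (scalar_field R k).
Local Notation T := (borelType G).

(* A function with values in R or C is measurable (resp. integrable) when its
   real and imaginary parts are. *)
Definition K_integrable (f : T -> K^o) : Prop :=
  mu.-integrable [set: T] (fun x => (re_part (f x))%:E) /\
  mu.-integrable [set: T] (fun x => (im_part (f x))%:E).

Lemma K_integrable_modulus (f : T -> K^o) : K_integrable f ->
  mu.-integrable [set: T] (fun x => (modulus (f x))%:E).
Proof.
move=> [fr fi].
have mr : measurable_fun [set: T] (re_part \o f).
  by apply/measurable_EFinP; have /integrableP[] := fr.
have mi : measurable_fun [set: T] (im_part \o f).
  by apply/measurable_EFinP; have /integrableP[] := fi.
apply: (le_integrable measurableT _ _
  (integrableD measurableT (integrable_abse fr) (integrable_abse fi))).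
  apply/measurable_EFinP; under eq_fun do rewrite modulusE.
  have mS : measurable_fun [set: R] (@Num.sqrt R).
    by apply: continuous_measurable_fun; exact: sqrt_continuous.
  apply: (measurableT_comp mS).
  by apply: measurable_funD; apply: measurable_funX.
move=> x _ /=; rewrite !lee_fin modulusE.
rewrite ger0_norm ?sqrtr_ge0// ger0_norm ?addr_ge0//.
rewrite -(ler_pXn2r (ltn0Sn 1)) ?nnegrE ?sqrtr_ge0 ?addr_ge0//.
rewrite sqr_sqrtr ?addr_ge0 ?sqr_ge0// sqrrD !real_normK ?num_real//.
by rewrite -addrA lerD2l lerDr mulrn_wge0// mulr_ge0.
Qed.

Definition L1_functions : {pred T -> K^o} := [pred f | `[< K_integrable f >]].

Lemma L1_functionsP (f : T -> K^o) : reflect (K_integrable f) (f \in L1_functions).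
Proof. exact: asboolP. Qed.

Lemma L1_submod_closed : submod_closed L1_functions.
Proof.
split.
  apply/L1_functionsP; split.
    by under eq_fun do rewrite re_part0; exact: integrable0.
  by under eq_fun do rewrite im_part0; exact: integrable0.
move=> a f h /L1_functionsP[fr fi] /L1_functionsP[hr hi].
apply/L1_functionsP; split.
  under eq_fun do rewrite re_partD re_partM EFinD EFinB !EFinM.
  by apply: integrableD => //; apply: integrableB => //; exact: integrableZl.
under eq_fun do rewrite im_partD im_partM EFinD EFinD !EFinM.
by apply: integrableD => //; apply: integrableD => //; exact: integrableZl.
Qed.

HB.instance Definition _ :=
  GRing.isSubmodClosed.Build K (T -> K^o) L1_functions L1_submod_closed.

Definition L1fun : Type := {f : T -> K^o | f \in L1_functions}.
HB.instance Definition _ := [isSub of L1fun for @sval _ _].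
HB.instance Definition _ := [Choice of L1fun by <:].
HB.instance Definition _ := [SubChoice_isSubLmodule of L1fun by <:].

Lemma L1funP (f : L1fun) : K_integrable (val f).
Proof. by apply/L1_functionsP; exact: (valP f). Qed.

Definition ae_equal (f h : L1fun) : bool :=
  `[< {ae mu, forall x, val f x = val h x} >].

Let ae_equal_refl : reflexive ae_equal.
Proof. by move=> f; apply/asboolP; apply: aeW. Qed.

Let ae_equal_sym : symmetric ae_equal.
Proof. by move=> f h; apply/asboolP/asboolP; apply: filterS => x ->. Qed.

Let ae_equal_trans : transitive ae_equal.
Proof.
move=> h f l /asboolP fh /asboolP hl; apply/asboolP.
by apply: filterS2 fh hl => x -> ->.
Qed.

Canonical ae_equal_equiv :=
  EquivRel ae_equal ae_equal_refl ae_equal_sym ae_equal_trans.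

Definition L1 : Type := {eq_quot ae_equal}%qT.
HB.instance Definition _ := Choice.on L1.
HB.instance Definition _ := EqQuotient.on L1.

Local Open Scope quotient_scope.

Lemma L1_eqP (f h : L1fun) :
  \pi_L1 f = \pi_L1 h <-> {ae mu, forall x, val f x = val h x}.
Proof.
split => [/eqmodP/asboolP//|fh]; exact/eqmodP/asboolP.
Qed.

Lemma L1_reprP (f : L1fun) : {ae mu, forall x, val (repr (\pi_L1 f)) x = val f x}.
Proof. by apply/L1_eqP; rewrite reprK. Qed.

Definition L1_zero : L1 := \pi_L1 0.
Definition L1_opp (f : L1) : L1 := \pi_L1 (- repr f).
Definition L1_add (f h : L1) : L1 := \pi_L1 (repr f + repr h).
Definition L1_scale (a : K) (f : L1) : L1 := \pi_L1 (a *: repr f).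

Lemma L1_oppE (f : L1fun) : L1_opp (\pi_L1 f) = \pi_L1 (- f).
Proof.
apply/L1_eqP; apply: filterS (L1_reprP f) => x fx.
by rewrite -[LHS]/(- val (repr _) x) fx.
Qed.

Lemma L1_addE (f h : L1fun) : L1_add (\pi_L1 f) (\pi_L1 h) = \pi_L1 (f + h).
Proof.
apply/L1_eqP; apply: filterS2 (L1_reprP f) (L1_reprP h) => x fx hx.
by rewrite -[LHS]/(val (repr _) x + val (repr _) x) fx hx.
Qed.

Lemma L1_scaleE a (f : L1fun) : L1_scale a (\pi_L1 f) = \pi_L1 (a *: f).
Proof.
apply/L1_eqP; apply: filterS (L1_reprP f) => x fx.
by rewrite -[LHS]/(a *: val (repr _) x) fx.
Qed.

Lemma L1W (P : L1 -> Prop) :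
  (forall f : L1fun, P (\pi_L1 f)) -> forall f, P f.
Proof. by move=> Ppi f; rewrite -[f]reprK. Qed.

Let L1_addA : associative L1_add.
Proof.
by elim/L1W=> f; elim/L1W=> h; elim/L1W=> l; rewrite !L1_addE addrA.
Qed.

Let L1_addC : commutative L1_add.
Proof. by elim/L1W=> f; elim/L1W=> h; rewrite !L1_addE addrC. Qed.

Let L1_add0 : left_id L1_zero L1_add.
Proof. by elim/L1W=> f; rewrite L1_addE add0r. Qed.

Let L1_addN : left_inverse L1_zero L1_opp L1_add.
Proof. by elim/L1W=> f; rewrite L1_oppE L1_addE addNr. Qed.

HB.instance Definition _ :=
  GRing.isZmodule.Build L1 L1_addA L1_addC L1_add0 L1_addN.

Let L1_scaleA a b (f : L1) : L1_scale a (L1_scale b f) = L1_scale (a * b) f.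
Proof. by elim/L1W: f => f; rewrite !L1_scaleE scalerA. Qed.

Let L1_scale1 : left_id 1 L1_scale.
Proof. by elim/L1W=> f; rewrite L1_scaleE scale1r. Qed.

Let L1_scaleDr : right_distributive L1_scale +%R.
Proof.
move=> a; elim/L1W=> f; elim/L1W=> h; rewrite -[_ + _]/(L1_add _ _).
by rewrite L1_addE !L1_scaleE -[RHS]/(L1_add _ _) L1_addE scalerDr.
Qed.

Let L1_scaleDl (f : L1) : {morph L1_scale^~ f : a b / a + b}.
Proof.
elim/L1W: f => f a b; rewrite !L1_scaleE -[RHS]/(L1_add _ _).
by rewrite L1_addE scalerDl.
Qed.

HB.instance Definition _ := GRing.Zmodule_isLmodule.Build K L1
  L1_scaleA L1_scale1 L1_scaleDr L1_scaleDl.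

Lemma L1_piD (f h : L1fun) : \pi_L1 (f + h) = \pi_L1 f + \pi_L1 h.
Proof. by rewrite -L1_addE. Qed.

Lemma L1_piZ (a : K) (f : L1fun) : \pi_L1 (a *: f) = a *: \pi_L1 f.
Proof. by rewrite -L1_scaleE. Qed.

Definition L1_norm (f : L1) : R :=
  fine (\int[mu]_x (modulus (val (repr f) x))%:E).

Lemma L1_normE (f : L1fun) :
  (L1_norm (\pi_L1 f))%:E = (\int[mu]_x (modulus (val f x))%:E)%E.
Proof.
have /K_integrable_modulus fi := L1funP f.
have /K_integrable_modulus rfi := L1funP (repr (\pi_L1 f)).
rewrite /L1_norm fineK; last exact: integrable_fin_num.
apply: ae_eq_integral => //.
- by have /integrableP[] := rfi.
- by have /integrableP[] := fi.
- by apply: filterS (L1_reprP f) => x -> _.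
Qed.

End IntegrableFunctions.

Arguments L1_functions {R} k {G} mu.

Section DualBall.
Variables (R : realType) (k : scalars) (G : topologicalGroupType).
Variable mu : {measure set (borelType G) -> \bar R}.
Local Notation K := (scalar_field R k).
Local Notation L1 := (L1 k mu).

(* The operator norm; it is [+oo] on the unbounded linear functionals. *)
Definition dual_norm (l : L1 -> K^o) : \bar R :=
  ereal_sup [set (modulus (l f))%:E | f in [set f : L1 | L1_norm f <= 1]].

Definition in_L1_dual (l : L1 -> K^o) : Prop :=
  linear l /\ (dual_norm l < +oo)%E.

Definition in_dual_ball (l : L1 -> K^o) : Prop :=
  in_L1_dual l /\ (dual_norm l <= 1)%E.

Definition dual_ball : Type := {l : L1 -> K^o | `[< in_dual_ball l >]}.
HB.instance Definition _ := [isSub of dual_ball for @sval _ _].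
HB.instance Definition _ := [Choice of dual_ball by <:].

Lemma dual_ballP (l : dual_ball) : in_dual_ball (val l).
Proof. exact/asboolP/(valP l). Qed.

Definition weak_star_ball : topologicalType :=
  sup_topology (fun f : L1 => Topological.class
    (initial_topology (fun l : dual_ball => val l f : K^o))).

End DualBall.

Section CanonicalAction.
Variables (R : realType) (k : scalars) (G : topologicalGroupType).
Variable mu : {measure set (borelType G) -> \bar R}.
Hypothesis hmu : left_haar_measure mu.
Local Notation K := (scalar_field R k).
Local Notation T := (borelType G).
Local Notation L1fun := (L1fun k mu).
Local Notation L1 := (L1 k mu).
Local Open Scope quotient_scope.

Let lt (g : G) : T -> T := left_translation g.

Let mlt (g : G) : measurable_fun [set: T] (lt g).
Proof. exact: measurable_left_translation. Qed.

Lemma haar_integral_translate (g : G) (u : T -> \bar R) :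
  measurable_fun [set: T] u -> (forall x, 0 <= u x)%E ->
  (\int[mu]_x u (lt g x) = \int[mu]_x u x)%E.
Proof.
move=> mu_u u0.
rewrite -[LHS](ge0_integral_pushforward (mlt g) mu measurableT)//.
by apply: eq_measure_integral => A mA _; exact: haar_pushforward.
Qed.

Lemma haar_integrable_translate (g : G) (u : T -> \bar R) :
  mu.-integrable [set: T] u -> mu.-integrable [set: T] (u \o lt g).
Proof.
move=> /integrableP[mu_u u_fin]; apply/integrableP; split.
  exact: measurableT_comp.
rewrite (haar_integral_translate g (u := fun x => `|u x|%E))//.
exact: measurableT_comp.
Qed.

Lemma translate_L1_functions (g : G) (f : L1fun) :
  (val f \o lt g : T -> K^o) \in L1_functions k mu.
Proof.
have [fr fi] := L1funP f; apply/L1_functionsP; split.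
  exact: (haar_integrable_translate g fr).
exact: (haar_integrable_translate g fi).
Qed.

Definition translate_fun (g : G) (f : L1fun) : L1fun :=
  Sub (val f \o lt g : T -> K^o) (translate_L1_functions g f).

(* the class of f \o lambda_G(g) *)
Definition translate (g : G) (f : L1) : L1 := \pi_L1 (translate_fun g (repr f)).

Lemma translateE (g : G) (f : L1fun) :
  translate g (\pi_L1 f) = \pi_L1 (translate_fun g f).
Proof.
apply/L1_eqP; have [N [mN N0 fN]] := L1_reprP f.
exists (lt g @^-1` N); split.
- by rewrite -[X in measurable X]setTI; exact: mlt.
- by rewrite -[LHS]/(pushforward mu (lt g) N) haar_pushforward.
- by move=> x /= fx; apply: fN.
Qed.

Lemma translate_linear (g : G) : linear (translate g).
Proof.
move=> a; elim/L1W=> f; elim/L1W=> h.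
transitivity (translate g (\pi_L1 (a *: f + h))).
  by congr (translate g _); rewrite L1_piD L1_piZ.
rewrite !translateE -L1_piZ -L1_piD.
by congr (\pi_L1 _); apply/val_inj.
Qed.

Lemma L1_norm_translate (g : G) (f : L1) : L1_norm (translate g f) = L1_norm f.
Proof.
elim/L1W: f => f; apply: EFin_inj; rewrite translateE !L1_normE.
have /K_integrable_modulus /integrableP[mf _] := L1funP f.
apply: (haar_integral_translate g mf) => x.
by rewrite lee_fin modulusE sqrtr_ge0.
Qed.

Lemma in_dual_ball_translate (g : G) (l : weak_star_ball k mu) :
  in_dual_ball (val (l : dual_ball k mu) \o translate g).
Proof.
have [[l_lin _] l_le1] := dual_ballP l.
suff lg_le1 : (dual_norm (val (l : dual_ball k mu) \o translate g) <= 1)%E.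
  split=> //; split; last exact: le_lt_trans lg_le1 (ltry 1).
  by move=> a f h /=; rewrite translate_linear l_lin.
apply: le_trans l_le1; apply: ge_ereal_sup => _ [f f_le1 <-].
apply: ereal_sup_ubound; exists (translate g f) => //=.
by rewrite L1_norm_translate.
Qed.

Definition canonical_action (g : G) (l : weak_star_ball k mu) :
    weak_star_ball k mu :=
  Sub (val (l : dual_ball k mu) \o translate g)
      (asboolT (in_dual_ball_translate g l)) : dual_ball k mu.

Lemma canonical_actionE (g : G) (l : weak_star_ball k mu) (f : L1) :
  val (canonical_action g l : dual_ball k mu) f =
  val (l : dual_ball k mu) (translate g f).
Proof. by []. Qed.

Lemma canonical_action1 (l : weak_star_ball k mu) : canonical_action 1%g l = l.
Proof.
apply: (@val_inj _ _ (dual_ball k mu)); apply/funext => f /=.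
congr (val (l : dual_ball k mu) _); elim/L1W: f => f; rewrite translateE.
by apply/L1_eqP/aeW => x /=; congr (val f _); exact: mul1g.
Qed.

Lemma canonical_actionM (g h : G) (l : weak_star_ball k mu) :
  canonical_action (g * h)%g l = canonical_action g (canonical_action h l).
Proof.
apply: (@val_inj _ _ (dual_ball k mu)); apply/funext => f /=.
congr (val (l : dual_ball k mu) _); elim/L1W: f => f; rewrite !translateE.
apply/L1_eqP/aeW => x /=; congr (val f _).
by rewrite /lt /left_translation mulgA.
Qed.

End CanonicalAction.

(* Main.v *)
Require Import Defs.
From HB Require Import structures.
From mathcomp Require Import all_boot all_order all_algebra finmap.
From mathcomp Require Import complex.
From mathcomp Require Import all_classical all_reals all_analysis.
From mathcomp Require Import measurable_realfun.
From mathcomp Require Import zify ring lra.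

(** The action of [g] on a functional [l] is tested on an indicator function of
    a compact neighbourhood [S] of 1 that generates [G]. If [G] is not compact,
    every third suffix of a shortest word of length [n] yields about [n/3]
    elements [h] of [S^n] with pairwise disjoint translates [h^-1 S]; a density
    in the unit ball of [L^oo] can be prescribed independently on each of them,
    so any cover separating [m] values of [l(1_S)] needs at least [m^(n/3)] sets
    along [S^n], and the entropy is at least [log2 m / 3] for every [m].
    If [G] is compact, the ball is compact (Banach-Alaoglu) and the action is
    jointly continuous (translation is continuous in [L^1]), so every cover has
    one finite refinement along the whole of [G] and the entropy is 0. *)

Set Implicit Arguments.
Unset Strict Implicit.
Unset Printing Implicit Defensive.

Import Order.TTheory GRing.Theory Num.Theory.
Import numFieldNormedType.Exports HBSimple.
Local Open Scope classical_set_scope.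
Local Open Scope ring_scope.

(** * Powers of generating sets *)

(** [compact_cover] speaks of pointed spaces: a point of [A] serves as base point, and the empty set
    is treated apart. *)
Lemma compact_finite_subcover (T : topologicalType) (I : choiceType)
    (f : I -> set T) (A : set T) :
  compact A -> (forall i, open (f i)) -> (forall x, A x -> exists i, f i x) ->
  exists D : {fset I}, forall x, A x -> exists2 i, i \in D & f i x.
Proof.
have [->|/set0P[x0 _]] := eqVneq A set0; first by exists fset0.
pose T' : ptopologicalType := HB.pack (Topological.sort T) (isPointed.Build T x0).
move=> cA fo fA; have : @compact T' A by [].
rewrite compact_cover => /(_ I setT f (fun i _ => fo i)) [x /fA[i fi]|D _ AD].
  by exists i.
by exists D => x /AD[i Di fi]; exists i.
Qed.

Section SetPowers.
Local Open Scope group_scope.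
Variable G : topologicalGroupType.
Implicit Types (S : set G) (x y g : G).

Lemma set_expg0 S : set_expg S 0 = [set 1].
Proof.
apply/seteqP; split => [_ [s _ <-]|_ ->]; first by rewrite big_ord0.
by exists (fun=> 1) => [[]//|]; rewrite big_ord0.
Qed.

Lemma set_expgS S n :
  set_expg S n.+1 = [set p.1 * p.2 | p in S `*` set_expg S n].
Proof.
apply/seteqP; split => [_ [s Ss <-]|_ [[x _] [/= Sx [s Ss <-]] <-]].
  exists (s ord0, \prod_(i < n) s (lift ord0 i)); last by rewrite big_ord_recl.
  by split => //=; exists (fun i => s (lift ord0 i)).
exists (fun i => if unlift ord0 i is Some j then s j else x).
  by move=> i /=; case: unliftP.
rewrite big_ord_recl unlift_none; congr (_ * _).
by apply: eq_bigr => i _; rewrite liftK.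
Qed.

Lemma set_expgSP S n g : set_expg S n.+1 g <->
  exists x y, [/\ S x, set_expg S n y & g = x * y].
Proof.
rewrite set_expgS; split => [[[x y] [/= Sx Sy] <-]|[x [y [Sx Sy ->]]]].
  by exists x, y.
by exists (x, y).
Qed.

Lemma set_expgD S m n x y :
  set_expg S m x -> set_expg S n y -> set_expg S (m + n) (x * y).
Proof.
elim: m x => [|m IH] x; first by rewrite set_expg0 => -> ?; rewrite mul1g.
move=> /set_expgSP[a [b [Sa Sb ->]]] Sy; rewrite addSn -mulgA.
by apply/set_expgSP; exists a, (b * y); split => //; exact: IH.
Qed.

Lemma set_expg1 S : set_expg S 1 = S.
Proof.
apply/seteqP; split => [_ /set_expgSP[a [b [Sa + ->]]]|a Sa].
  by rewrite set_expg0 => ->; rewrite mulg1.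
by apply/set_expgSP; exists a, 1; rewrite set_expg0 mulg1.
Qed.

Lemma set_expg_mem1 S n : S 1 -> set_expg S n 1.
Proof. by exists (fun=> 1) => //; rewrite big1. Qed.

Lemma set_expg_le S m n : S 1 -> (m <= n)%N -> set_expg S m `<=` set_expg S n.
Proof.
move=> S1 mn x Sx; rewrite -(subnK mn) -[x]mul1g.
by apply: set_expgD => //; exact: set_expg_mem1.
Qed.

Lemma set_expgV S n x : (forall x, S x -> S x^-1) ->
  set_expg S n x -> set_expg S n x^-1.
Proof.
move=> SV; elim: n x => [|n IH] x.
  by rewrite set_expg0 => ->; rewrite /= invg1.
move=> /set_expgSP[a [b [Sa Sb ->]]]; rewrite invgM -addn1.
by apply: set_expgD; [exact: IH|rewrite set_expg1; exact: SV].
Qed.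

Lemma compact_set_expg S n : compact S -> compact (set_expg S n).
Proof.
move=> cS; elim: n => [|n IH]; first by rewrite set_expg0; exact: compact_set1.
rewrite set_expgS; apply: continuous_compact; last exact: compact_setX.
by apply: continuous_subspaceT; exact: mulg_continuous.
Qed.

Lemma left_translation_continuous g : continuous (left_translation g : G -> G).
Proof.
move=> x; apply: (@continuous_comp _ _ _ (fun x => (g, x))
  (fun x : G * G => x.1 * x.2)); last exact: mulg_continuous.
by apply: cvg_pair => /=; [exact: cvg_cst|exact: cvg_id].
Qed.

Lemma left_translation_imageE g S :
  left_translation g @` S = left_translation g^-1 @^-1` S.
Proof.
rewrite /left_translation; apply/seteqP; split => [_ [x Sx <-]|x Sx] /=.
  by rewrite mulKg.
by exists (g^-1 * x) => //; rewrite mulVKg.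
Qed.

Lemma open_left_translation g S : open S -> open (left_translation g @` S).
Proof.
move=> oS; rewrite left_translation_imageE.
by have /continuousP := left_translation_continuous (g := g^-1); exact.
Qed.

(* A symmetric neighbourhood of 1 that absorbs finitely many coset
   representatives of the open subgroup it generates. *)
Lemma almost_connected_generating_nbhd :
  almost_connected G -> locally_compact [set: G] ->
  exists S, [/\ compact_generating S, nbhs (1 : G) S &
    forall x, S x -> S x^-1].
Proof.
move=> acG lcG.
have [K] := lcG 1 I; rewrite withinET => nK [cK _].
pose W := K `|` (fun x : G => x^-1) @` K.
have cV C : compact C -> compact ((fun x : G => x^-1) @` C : set G).
  move=> cC; apply: continuous_compact => //.
  by apply: continuous_subspaceT; exact: invg_continuous.
have symU C x : (C `|` (fun x : G => x^-1) @` C) x ->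
    (C `|` (fun x : G => x^-1) @` C) x^-1.
  by case=> [Cx|[y Cy <-]]; [right; exists x|left; rewrite invgK].
have cW : compact W by apply: compactU => //; exact: cV.
have nW : nbhs (1 : G) W by apply: filterS nK => x; left.
have W1 : W 1 := nbhs_singleton nW.
pose H := \bigcup_n set_expg W n.
have H1 : H 1 by exists 0%N => //; rewrite set_expg0.
have HM x y : H x -> H y -> H (x * y).
  by move=> [m _ Wx] [n _ Wy]; exists (m + n)%N => //; exact: set_expgD.
have HV x : H x -> H x^-1.
  by move=> [n _ Wx]; exists n => //; apply: set_expgV => // y; exact: symU.
have oH : open H.
  rewrite openE => x Hx.
  have : nbhs x (left_translation x^-1 @^-1` W).
    apply: left_translation_continuous.
    by rewrite /left_translation mulVg.
  apply: filterS => y Wy.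
  rewrite -[y](mulVKg x); apply: HM => //.
  by exists 1%N => //; rewrite set_expg1.
(* If [x] is outside the open subgroup [H], its coset [x H] is a neighbourhood of [x] that misses
   [H]. *)
have clH : closed H.
  rewrite -openC openE => x nHx.
  have : nbhs x (left_translation x^-1 @^-1` H).
    apply: left_translation_continuous.
    by rewrite /left_translation mulVg; exact: open_nbhs_nbhs.
  apply: filterS => y Hy /= Hy'; apply: nHx.
  have := HM _ _ Hy' (HV _ Hy).
  by rewrite /left_translation invgM invgK mulVKg.
(* A clopen set containing 1 meets the connected identity component in a nonempty clopen part, hence
   contains it. *)
have NH : @identity_component G `<=` H.
  have -> : @identity_component G = @identity_component G `&` H; last by move=> x [].
  apply/esym/(@component_connected G setT 1).
  - by exists 1; split => //; exact: connected_component_refl.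
  - by exists H.
  - by exists H.
have cosetN (x y : G) : left_coset x = left_coset y -> H (x^-1 * y).
  move=> xy; apply: NH; have : left_coset y y.
    by exists 1; [exact: connected_component_refl|rewrite /left_translation mulg1].
  by rewrite -xy => -[z Nz <-]; rewrite /left_translation mulKg.
pose piG : G -> component_quotient G := \pi_(component_quotient G)%qT.
have piP x y : piG x = piG y -> H (x^-1 * y).
  by move=> /eqmodP /asboolP; exact: cosetN.
(* As [H] contains the identity component, the preimage of [U x] is exactly the open coset [x H]. So
   the [U x] form an open cover of the compact quotient. *)
pose U (x : G) : set (component_quotient G) := piG @` (left_translation x @` H).
have piU x : piG @^-1` U x = left_translation x @` H.
  apply/seteqP; split => [y [_ [z Hz <-] /piP zy]|y Hy]; last by exists y.
  exists (z * ((left_translation x z)^-1 * y)); first exact: HM.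
  by rewrite /left_translation mulgA mulVKg.
have [x|q _|D Dcov] := compact_finite_subcover (f := U) acG.
- by rewrite /open /= /quotient_open piU; exact: open_left_translation.
- exists (repr q); exists (repr q); last exact: reprK.
  by exists 1 => //; rewrite /left_translation mulg1.
pose F := [set` D].
have fF : finite_set F by exact: finite_fset.
(* [F] holds finitely many representatives of the cosets of [H]: each element of [G] is one letter
   of [F] times a word in [W]. *)
pose S := W `|` (F `|` (fun x : G => x^-1) @` F).
exists S; split.
- split.
    apply: compactU => //; apply: compactU; first exact: finite_compact.
    by apply: cV; exact: finite_compact.
  split; first by left.
  apply/seteqP; split => // x _.
  have [g Dg] := Dcov (piG x) I.
  rewrite -[U g _]/((piG @^-1` U g) x) piU => -[h [n _ Wh] <-].
  exists n.+1 => //; apply/set_expgSP; exists g, h; split => //.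
    by right; left.
  by case: Wh => s Ws <-; exists s => // i; left.
- by apply: filterS nW => x; left.
- by move=> x [/symU|/symU]; [left|right].
Qed.

(** If [S^(n+1)] lay in [S^n], so would every power, and [G = S^n] would be compact. *)
Lemma set_expg_strict S n : compact_generating S -> ~ compact [set: G] ->
  exists2 g, set_expg S n.+1 g & ~ set_expg S n g.
Proof.
move=> [cS [S1 Sgen]] ncG; apply: contrapT => stable.
have sub1 : set_expg S n.+1 `<=` set_expg S n.
  by move=> g Sg; apply: contrapT => nSg; apply: stable; exists g.
have sub m : set_expg S m `<=` set_expg S n.
  elim: m => [|m IH]; first exact: set_expg_le.
  move=> _ /set_expgSP[x [y [Sx /IH Sy ->]]]; apply: sub1.
  by apply/set_expgSP; exists x, y.
apply: ncG; rewrite (_ : [set: G] = set_expg S n); first exact: compact_set_expg.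
by apply/seteqP; split => // x; rewrite -Sgen => -[m _]; exact: sub.
Qed.

(** [h i] is the suffix of length [i] of a word for [g]. After index [n] the sequence is constant,
    which is allowed since [S] contains 1. *)
Lemma set_expg_chain S n g : S 1 -> set_expg S n g ->
  exists h : nat -> G, [/\ h 0%N = 1, h n = g &
    forall i, S (h i.+1 * (h i)^-1)].
Proof.
move=> S1; elim: n g => [|n IH] g.
  by rewrite set_expg0 => ->; exists (fun=> 1); split => // i; rewrite mulgV.
move=> /set_expgSP[x [y [Sx /IH[h [h0 hn hS]] ->]]].
exists (fun i => if (i <= n)%N then h i else x * y); rewrite ltnn; split => // i.
case: ltngtP => [ni|ni|->]; first exact: hS.
  by rewrite mulgV.
by rewrite hn mulgK.
Qed.

Lemma chain_set_expg S (h : nat -> G) i j : (forall i, S (h i.+1 * (h i)^-1)) ->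
  (i <= j)%N -> set_expg S (j - i) (h j * (h i)^-1).
Proof.
move=> hS /subnK <-; move: (j - i)%N => {}j; rewrite addnK.
elim: j => [|j IH]; first by rewrite mulgV set_expg0.
apply/set_expgSP; exists (h (j + i).+1 * (h (j + i))^-1), (h (j + i) * (h i)^-1).
by split=> //; rewrite mulgA mulgVK.
Qed.

(* Every third suffix of a word of minimal length. *)
Lemma disjoint_translates S n : compact_generating S ->
  (forall x, S x -> S x^-1) -> ~ compact [set: G] ->
  exists h : nat -> G,
    (forall t, (t < (n %/ 3).+1)%N -> set_expg S n (h t)) /\
    (forall t u, (t < u < (n %/ 3).+1)%N ->
      left_translation (h t)^-1 @` S `&` left_translation (h u)^-1 @` S = set0).
Proof.
move=> gS SV ncG; have [_ [S1 _]] := gS.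
case: n => [|n].
  exists (fun=> 1); split => [t _|t u]; first by rewrite set_expg0.
  by rewrite div0n; lia.
(* [g] has word length exactly [n.+1], so no word for it can be shortened. *)
have [g Sg nSg] := set_expg_strict n gS ncG.
have [h [h0 hn hS]] := set_expg_chain S1 Sg.
have le3 t : (t < (n.+1 %/ 3).+1)%N -> (t * 3 <= n.+1)%N.
  by rewrite ltnS leq_divRL.
exists (fun t => h (t * 3)%N); split => [t /le3 tn|t u /andP[tu /le3 un]].
  apply: (set_expg_le S1 tn).
  have := chain_set_expg hS (leq0n (t * 3)%N).
  by rewrite subn0 h0 invg1 mulg1.
(* A common point of the translates gives [h (u * 3) * (h (t * 3))^-1 = b * a^-1]. This replaces at
   least three letters of the word by two, so [g] would lie in [S^n]. *)
apply/seteqP; split => // x [[a Sa <-] [b Sb]].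
rewrite /left_translation => /(congr1 (fun z => h (u * 3)%N * z * a^-1)).
rewrite mulVKg mulgA mulgK => ba; apply: nSg; rewrite -hn.
have S2 : set_expg S 2 (h (u * 3)%N * (h (t * 3)%N)^-1).
  rewrite -ba; apply: (@set_expgD _ 1 1); rewrite set_expg1 //.
  exact: SV.
have tu3 : (t * 3 + 3 <= u * 3)%N by rewrite -mulSnr leq_mul2r tu orbT.
have t0 := chain_set_expg hS (leq0n (t * 3)%N).
rewrite subn0 h0 invg1 mulg1 in t0.
have := set_expgD (set_expgD (chain_set_expg hS un) S2) t0.
rewrite mulgA mulgVK mulgVK; apply: (set_expg_le S1).
by move: tu3 un; lia.
Qed.

End SetPowers.

(** * Entropy estimates *)

Section EntropyBounds.
Variables (R : realType) (G : topologicalGroupType) (X : topologicalType).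
Variable alpha : G -> X -> X.

(** For each word [s], choose a member of the refinement containing [p s]. Two words with the same
    choice are sent by every [h t] into a common member of [U], so they agree; the choice is
    injective on [k ^ m] words. *)
Lemma covering_number_ge (m k : nat) (S : set G) (U : set (set X))
    (h : 'I_m -> G) (p : {ffun 'I_m -> 'I_k} -> X) :
  (forall t, S (h t)) ->
  (forall A t s u, U A -> A (alpha (h t) (p s)) -> A (alpha (h t) (p u)) ->
    s t = u t) ->
  ((k ^ m)%:R%:E <= covering_number R alpha S U)%E.
Proof.
move=> Sh sep; apply: le_ereal_inf_tmp => _ [V [[finV _ Vcov] ref] <-].
rewrite lee_fin ler_nat.
have /choice[v vP] s : exists B, V B /\ B (p s).
  have : [set: X] (p s) by [].
  by rewrite -Vcov => -[B VB Bp]; exists B.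
have vV s : v s \in fset_set V.
  by rewrite in_fset_set// inE; have [] := vP s.
pose w s : fset_set V := [` vV s]%fset.
rewrite cardfE -[k in (k ^ _)%N]card_ord -[m in (_ ^ m)%N]card_ord -card_ffun.
apply: (leq_card w) => s u [vsu]; apply/ffunP => t.
have [Vs Bs] := vP s; have [_ Bu] := vP u.
have [A UA hBA] := ref _ _ (Sh t) Vs.
apply: (sep A t) => //; apply: hBA; first by exists (p s).
by exists (p u) => //; rewrite vsu.
Qed.

Lemma covering_number_ge0 (S : set G) (U : set (set X)) :
  (0 <= covering_number R alpha S U)%E.
Proof. by apply: le_ereal_inf_tmp => _ [V _ <-]; rewrite lee_fin. Qed.

Lemma log2e_le (x y : \bar R) : (0 <= x)%E -> (x <= y)%E ->
  (log2e x <= log2e y)%E.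
Proof.
move=> x0 xy; rewrite /log2e lee_pmul2r ?ltry//; last first.
- by rewrite lte_fin invr_gt0 ln_gt0// ltr1n.
- by rewrite lee_lne// in_itv /= leey andbT// (le_trans x0).
Qed.

Lemma ln2_gt0 : 0 < ln (2 : R).
Proof. by rewrite ln_gt0// ltr1n. Qed.

Lemma covering_entropy_ge (S : set G) (U : set (set X)) (k : nat) :
  (0 < k)%N ->
  (forall n, (k ^ (n %/ 3).+1)%:R%:E <= covering_number R alpha (set_expg S n) U)%E ->
  ((ln (k%:R : R) / (3 * ln 2))%:E <= covering_entropy R alpha S U)%E.
Proof.
move=> k0 hk; apply: le_ereal_inf_tmp => _ [A [N _ NA] <-].
(* The supremum over the tail is tested at [N.+1], since the inverse of 0 is 0 by convention. The
   factor 1/3 comes from [(n %/ 3).+1] being at least [n / 3]. *)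
apply: (@le_trans _ _ (log2e (covering_number R alpha (set_expg S N.+1) U)
   * ((N.+1)%:R^-1)%:E)%E); last first.
  by apply: ereal_sup_ubound; exists N.+1 => //; apply: NA => /=.
have km0 : (0 : R) < (k ^ (N.+1 %/ 3).+1)%:R by rewrite ltr0n expn_gt0 k0.
apply: (@le_trans _ _ (log2e ((k ^ (N.+1 %/ 3).+1)%:R : R)%:E
   * ((N.+1)%:R^-1)%:E)%E); last first.
  by apply: lee_wpmul2r; rewrite ?lee_fin ?invr_ge0// log2e_le// lee_fin ltW.
rewrite /log2e lne_EFin// -!EFinM lee_fin natrX lnXn ?ltr0n//.
have L0 : 0 <= ln (k%:R : R) by rewrite ln_ge0// ler1n.
have := ln2_gt0; set L := ln k%:R in L0 *; set c := ln 2 => c0.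
have N0 : (0 : R) < N.+1%:R by rewrite ltr0n.
have -> : L / (3 * c) = L / c * 3^-1 by rewrite invfM mulrA mulrAC.
rewrite -[L *+ _]mulr_natr [X in _ <= X / _]mulrAC -(mulrA (L / c)).
apply: ler_wpM2l; first by rewrite divr_ge0// ltW.
rewrite ler_pdivlMr// mulrC ler_pdivrMr// -natrM ler_nat; lia.
Qed.

Lemma entropy_infinite (S : set G) :
  (forall k, (0 < k)%N -> exists2 U : set (set X), finite_open_covering U &
    forall n, ((k ^ (n %/ 3).+1)%:R%:E
               <= covering_number R alpha (set_expg S n) U)%E) ->
  entropy R alpha S = +oo%E.
Proof.
move=> hU; apply/eqyP => M _; have c3 : 0 < 3 * ln (2 : R) by have := ln2_gt0; lra.
(* Chosen so that [ln k / (3 * ln 2)] is at least [M]. *)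
pose k := (Num.truncn (expR (M * (3 * ln 2)))).+1.
have [U covU kU] := hU k isT.
apply: (@le_trans _ _ (ln (k%:R : R) / (3 * ln 2))%:E); last first.
  apply: (le_trans (covering_entropy_ge _ kU)) => //.
  by apply: ereal_sup_ubound; exists U.
rewrite lee_fin ler_pdivlMr// -[leLHS]expRK ler_ln ?posrE ?expR_gt0 ?ltr0n//.
by apply: ltW; rewrite truncnS_gt.
Qed.

Lemma entropy_le0 (S : set G) :
  (forall U, finite_open_covering U -> exists N : nat,
    forall n, (covering_number R alpha (set_expg S n) U <= N%:R%:E)%E) ->
  (entropy R alpha S <= 0)%E.
Proof.
move=> hU; apply: ge_ereal_sup => _ [U covU <-].
have {hU}[N hN] := hU _ covU.
(* The successor keeps the logarithm nonnegative even when [N] is 0. *)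
pose c : R := ln N.+1%:R / ln 2.
have cge0 : 0 <= c by rewrite divr_ge0 ?ln_ge0 ?ler1n// ltW// ln2_gt0.
have le_c n : (log2e (covering_number R alpha (set_expg S n) U)
    * (n%:R^-1)%:E <= (c / n%:R)%:E)%E.
  rewrite EFinM lee_wpmul2r// ?lee_fin ?invr_ge0//.
  apply: (@le_trans _ _ (log2e N.+1%:R%:E)); last first.
    by rewrite /log2e lne_EFin ?ltr0n// -EFinM.
  apply: log2e_le; first exact: covering_number_ge0.
  by apply: (le_trans (hN n)); rewrite lee_fin ler_nat.
apply/lee_addgt0Pr => e e0; rewrite add0e.
(* Past this index, [c / n] is at most [e]. *)
pose n0 := (Num.truncn (c / e)).+1.
apply: (@le_trans _ _ (ereal_sup [set log2e (covering_number R alpha (set_expg S n) U)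
                      * (n%:R^-1)%:E | n in [set n | (n0 <= n)%N]])%E).
  by apply: ereal_inf_lbound; exists [set n | (n0 <= n)%N] => //; exists n0.
apply: ge_ereal_sup => _ [n /= n0n <-]; apply: (le_trans (le_c n)).
have n_gt0 : 0 < n%:R :> R by rewrite ltr0n (leq_trans _ n0n).
rewrite lee_fin ler_pdivrMr// mulrC -ler_pdivrMr//.
by apply: (@le_trans _ _ n0%:R); rewrite ?ler_nat// ltW// truncnS_gt.
Qed.

End EntropyBounds.

(** * Scalars and the weak-* topology *)

Section MoreScalars.
Variables (R : realType) (k : scalars).
Local Notation K := (scalar_field R k).
Implicit Types (x y : K) (a b : R).

(* In the real case the prescribed imaginary part [b] is ignored. *)
Definition mk_scalar a b : K :=
  match k return scalar_field R k with
  | RealScalars => a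
  | ComplexScalars => Complex a b
  end.

Lemma scalar_eqP x y : re_part x = re_part y -> im_part x = im_part y -> x = y.
Proof. by case: k x y => //= -[a b] [c d] /= -> ->. Qed.

Lemma re_mk_scalar a b : re_part (mk_scalar a b) = a.
Proof. by rewrite /mk_scalar; case: k. Qed.

(** Lets one proof serve both fields, which then differ only where imaginary parts enter. *)
Lemma im_mk_scalarP :
  (forall x, im_part x = 0) \/ (forall a b, im_part (mk_scalar a b) = b).
Proof. by rewrite /mk_scalar; case: k; [left|right]. Qed.

Lemma im_mk_scalar0 a : im_part (mk_scalar a 0) = 0.
Proof. by rewrite /mk_scalar; case: k. Qed.

Lemma modulus_ge0 x : 0 <= modulus x.
Proof. by rewrite modulusE sqrtr_ge0. Qed.

Lemma sqr_modulus x : modulus x ^+ 2 = re_part x ^+ 2 + im_part x ^+ 2.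
Proof. by rewrite modulusE sqr_sqrtr// addr_ge0 ?sqr_ge0. Qed.

(** Cauchy-Schwarz in the plane: the squares of the two sides differ by [(a * d - b * c)^2]. *)
Lemma scalar_inner_le x y :
  `|re_part x * re_part y + im_part x * im_part y| <= modulus x * modulus y.
Proof.
set a := re_part x; set b := im_part x; set c := re_part y; set d := im_part y.
rewrite -ler_sqr ?nnegrE ?mulr_ge0 ?modulus_ge0// real_normK ?num_real//.
rewrite exprMn !sqr_modulus -/a -/b -/c -/d.
have := sqr_ge0 (a * d - b * c); nra.
Qed.

Lemma modulus_le x : modulus x <= `|re_part x| + `|im_part x|.
Proof.
rewrite -ler_sqr ?nnegrE ?addr_ge0 ?modulus_ge0// sqr_modulus sqrrD.
by rewrite !real_normK ?num_real// lerD2r lerDl mulrn_wge0 ?mulr_ge0.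
Qed.

Lemma norm_scalarE x : `|x| = mk_scalar (modulus x) 0.
Proof. by rewrite /mk_scalar /modulus; case: k x => //= -[a b]. Qed.

Lemma mk_scalar_lt a b : (mk_scalar a 0 < mk_scalar b 0) = (a < b).
Proof. by rewrite /mk_scalar; case: k => //=; rewrite ltcE /= eqxx. Qed.

Lemma gt0_scalarE x : 0 < x -> exists2 e : R, 0 < e & x = mk_scalar e 0.
Proof.
rewrite /mk_scalar; case: k x => [x|[a b]] /=; first by exists x.
by rewrite ltcE /= => /andP[/eqP -> a0]; exists a.
Qed.

Lemma modulusM x y : modulus (x * y) = modulus x * modulus y.
Proof.
apply/eqP; rewrite -(@eqrXn2 _ 2) ?mulr_ge0 ?modulus_ge0//.
rewrite exprMn !sqr_modulus re_partM im_partM; apply/eqP; ring.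
Qed.

Lemma modulusD x y : modulus (x + y) <= modulus x + modulus y.
Proof.
rewrite -ler_sqr ?nnegrE ?addr_ge0 ?modulus_ge0// sqrrD !sqr_modulus.
rewrite re_partD im_partD; have := le_trans (ler_norm _) (scalar_inner_le x y); lra.
Qed.

Lemma modulus_mk_scalar a : 0 <= a -> modulus (mk_scalar a 0) = a.
Proof.
move=> a0; rewrite modulusE re_mk_scalar im_mk_scalar0.
by rewrite expr0n addr0 sqrtr_sqr ger0_norm.
Qed.

End MoreScalars.

(** * The weak-* topology as pointwise convergence *)

Section WeakStar.
Variables (R : realType) (k : scalars) (G : topologicalGroupType).
Variable mu : {measure set (borelType G) -> \bar R}.
Local Notation K := (scalar_field R k).
Local Notation X := (weak_star_ball k mu).

Definition evaluation (f : L1 k mu) (l : X) : K^o := val (l : dual_ball k mu) f.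

Lemma weak_star_cvgP (F : set_system X) (l : X) : Filter F ->
  F --> l <-> forall f, evaluation f @ F --> evaluation f l.
Proof.
move=> FF; split=> [Fl f|Fl].
  move=> A lA; have /(_ f) Flf := iffLR (cvg_sup _ _ FF) Fl.
  apply: (Flf (evaluation f @^-1` A)).
  exact: (@initial_continuous (dual_ball k mu) K^o (fun l => val l f)).
apply/cvg_sup => f A [_ [[B oB <-] /= Bl BA]].
have FB : F (evaluation f @^-1` B) by apply: Fl; exact: open_nbhs_nbhs.
exact: (@filterS _ F FF _ _ BA FB).
Qed.

Lemma evaluation_continuous f : continuous (evaluation f).
Proof. move=> l; apply: (iffLR (weak_star_cvgP l (nbhs_filter l)) _ f).
exact: cvg_id. Qed.

End WeakStar.

(** * Functionals given by a density *)

Section DensityFunctional.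
Variables (R : realType) (k : scalars) (G : topologicalGroupType).
Variable mu : {measure set (borelType G) -> \bar R}.
Local Notation K := (scalar_field R k).
Local Notation T := (borelType G).
Local Notation L1fun := (L1fun k mu).
Local Notation L1 := (L1 k mu).
Local Open Scope quotient_scope.
Variable phi : T -> R.
Hypothesis mphi : measurable_fun [set: T] phi.
Hypothesis phi_le1 : forall x, `|phi x| <= 1.

Let integrable_mul (u : T -> R) : mu.-integrable [set: T] (EFin \o u) ->
  mu.-integrable [set: T] (EFin \o (fun x => phi x * u x)).
Proof.
move=> iu; have /integrableP[/measurable_EFinP mu_ _] := iu.
apply: (le_integrable measurableT _ _ iu).
  by apply/measurable_EFinP; exact: measurable_funM.
by move=> x _; rewrite /= lee_fin normrM ler_piMl.
Qed.

Let pair (u : T -> R) : R := (\int[mu]_x (phi x * u x))%R.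

Let pairD u v : mu.-integrable [set: T] (EFin \o u) ->
  mu.-integrable [set: T] (EFin \o v) ->
  pair (fun x => u x + v x) = pair u + pair v.
Proof.
move=> iu iv; rewrite -[RHS]RintegralD//; try exact: integrable_mul.
by apply: eq_Rintegral => x _; rewrite mulrDr.
Qed.

Let pairZ c u : mu.-integrable [set: T] (EFin \o u) ->
  pair (fun x => c * u x) = c * pair u.
Proof.
move=> iu; rewrite -[RHS]RintegralZl//; last exact: integrable_mul.
by apply: eq_Rintegral => x _; rewrite mulrCA.
Qed.

Let integrableZ c u : mu.-integrable [set: T] (EFin \o u) ->
  mu.-integrable [set: T] (EFin \o (fun x => c * u x)).
Proof. exact: integrableZl. Qed.

Let integrableA u v : mu.-integrable [set: T] (EFin \o u) ->
  mu.-integrable [set: T] (EFin \o v) ->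
  mu.-integrable [set: T] (EFin \o (fun x => u x + v x)).
Proof. exact: integrableD. Qed.

(** The integral of [phi * f], assembled from its real and imaginary parts because [Rintegral] is
    real-valued. *)
Definition density_pairing (f : L1fun) : K :=
  mk_scalar k (pair (fun x => re_part (val f x)))
              (pair (fun x => im_part (val f x))).

Let re_density_pairing f :
  re_part (density_pairing f) = pair (fun x => re_part (val f x)).
Proof. exact: re_mk_scalar. Qed.

Let im_density_pairing f :
  im_part (density_pairing f) = pair (fun x => im_part (val f x)).
Proof.
have [im0|->//] := im_mk_scalarP R k; rewrite im0.
rewrite -[LHS](mul0r (pair (fun=> 0))) -pairZ; last exact: integrable0.
by apply: eq_Rintegral => x _; rewrite im0 mul0r.
Qed.

Let re_integrable (f : L1fun) :
  mu.-integrable [set: T] (EFin \o (fun x => re_part (val f x))).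
Proof. by have [] := L1funP f. Qed.

Let im_integrable (f : L1fun) :
  mu.-integrable [set: T] (EFin \o (fun x => im_part (val f x))).
Proof. by have [] := L1funP f. Qed.

(** For [z] the pairing and [r] its modulus, [r^2] is the integral of [phi] times the real part of
    [conj(z) * f]. By Cauchy-Schwarz it is at most [r] times the integral of the modulus of [f], and
    a positive [r] cancels. *)
Lemma modulus_density_pairing f :
  ((modulus (density_pairing f))%:E <= \int[mu]_x (modulus (val f x))%:E)%E.
Proof.
set z := density_pairing f; set r := modulus z.
have [r0|r_gt0] := leP r 0.
  apply: (@le_trans _ _ 0%E); first by rewrite lee_fin.
  by apply: integral_ge0 => x _; rewrite lee_fin modulus_ge0.
have mf := K_integrable_modulus (L1funP f).
have ifm : (\int[mu]_x (modulus (val f x))%:E)%E \is a fin_num.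
  exact: integrable_fin_num.
rewrite -(fineK ifm) lee_fin -(ler_pM2l r_gt0) -expr2 sqr_modulus !expr2.
rewrite {2}re_density_pairing {2}im_density_pairing -!pairZ// -pairD;
  try exact: integrableZ.
have imf : mu.-integrable [set: T] (EFin \o (fun x => r * modulus (val f x))).
  exact: integrableZ.
rewrite -[leRHS](RintegralZl r measurableT mf); apply: le_Rintegral => //.
  by apply/integrable_mul/integrableA; exact: integrableZ.
move=> x _; apply: le_trans (scalar_inner_le z (val f x)).
by apply: le_trans (ler_norm _) _; rewrite normrM ler_piMl.
Qed.

Definition density_functional (f : L1) : K^o := density_pairing (repr f).

Lemma density_functionalE f : density_functional (\pi f) = density_pairing f.
Proof.
rewrite /density_functional /density_pairing /Rintegral.
congr (mk_scalar _ (fine _) (fine _)); apply: ae_eq_integral => //.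
- by have /integrable_mul/integrableP[] := re_integrable (repr (\pi_L1 f)).
- by have /integrable_mul/integrableP[] := re_integrable f.
- by apply: filterS (L1_reprP f) => x -> _.
- by have /integrable_mul/integrableP[] := im_integrable (repr (\pi_L1 f)).
- by have /integrable_mul/integrableP[] := im_integrable f.
- by apply: filterS (L1_reprP f) => x -> _.
Qed.

Lemma density_functional_le f : modulus (density_functional f) <= L1_norm f.
Proof.
elim/L1W: f => f; rewrite -lee_fin L1_normE density_functionalE.
exact: modulus_density_pairing.
Qed.

Lemma density_functional_linear : linear density_functional.
Proof.
move=> a; elim/L1W=> f; elim/L1W=> h; rewrite -L1_piZ -L1_piD !density_functionalE.
apply: scalar_eqP.
  rewrite re_partD re_partM !re_density_pairing im_density_pairing.
  rewrite -mulNr -!pairZ// -!pairD//; do ?[exact: integrableZ|apply: integrableA].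
  by apply: eq_Rintegral => x _; rewrite re_partD re_partM mulNr.
rewrite im_partD im_partM !im_density_pairing re_density_pairing.
rewrite -!pairZ// -!pairD//; do ?[exact: integrableZ|apply: integrableA].
by apply: eq_Rintegral => x _; rewrite im_partD im_partM.
Qed.

Lemma in_dual_ball_density : in_dual_ball density_functional.
Proof.
suff le1 : (dual_norm density_functional <= 1)%E.
  split=> //; split; first exact: density_functional_linear.
  exact: le_lt_trans le1 (ltry 1).
apply: ge_ereal_sup => _ [f /= f1 <-]; rewrite lee_fin.
exact: le_trans (density_functional_le f) f1.
Qed.

Definition density_ball : weak_star_ball k mu :=
  Sub density_functional (asboolT in_dual_ball_density) : dual_ball k mu.

End DensityFunctional.

(** * Non-compact groups *)

Lemma indic_integrable (d : measure_display) (T : measurableType d)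
    (R : realType) (mu : {measure set T -> \bar R}) (A : set T) :
  measurable A -> (mu A < +oo)%E ->
  mu.-integrable [set: T] (EFin \o (\1_A : T -> R)).
Proof.
move=> mA Afin; apply/integrableP; split; first exact/measurable_EFinP.
under eq_integral do rewrite gee0_abs ?lee_fin//.
by rewrite integral_indic// setIT.
Qed.

(** * Borel sets and positivity of Haar measure *)

Section HaarFacts.
Variables (R : realType) (G : topologicalGroupType).
Variable mu : {measure set (borelType G) -> \bar R}.
Hypothesis hmu : left_haar_measure mu.
Local Notation T := (borelType G).

Lemma borel_open (O : set G) : open O -> measurable (O : set T).
Proof. by move=> oO; apply: sub_sigma_algebra. Qed.

Lemma borel_compact (C : set G) : hausdorff_space G -> compact C ->
  measurable (C : set T).
Proof.
move=> hG cC; rewrite -[C]setCK; apply: measurableC; apply: borel_open.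
by apply: closed_openC; exact: compact_closed.
Qed.

(** If [S] were null, so would be every compact set, being covered by finitely many translates of
    the interior of [S]. Inner regularity would then make the whole measure zero. *)
Lemma haar_nbhs_gt0 (S : set G) : hausdorff_space G ->
  nbhs (1%g : G) S -> measurable (S : set T) -> (0 < mu S)%E.
Proof.
move=> hG nS mS; rewrite lt0e measure_ge0 andbT.
apply/eqP => S0; have /eqP := haar_neq0 hmu; apply.
pose O := S^°; have oO : open O by exact: open_interior.
have negO g : mu.-negligible (left_translation g @` O : set T).
  apply/negligibleP; first by apply: borel_open; exact: open_left_translation.
  transitivity (mu O); first exact: (haar_left_invariant hmu g (borel_open oO)).
  apply/eqP; rewrite -measure_le0 -S0 le_measure ?inE//; first exact: borel_open.
  exact: interior_subset.
apply/eqP; rewrite -measure_le0.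
rewrite [X in (X <= _)%E](haar_inner_regular hmu openT).
apply: ge_ereal_sup => _ [C [cC _] <-].
rewrite measure_le0; apply/eqP/measure_negligible; first exact: borel_compact.
have [g|x _|D Dcov] :=
    compact_finite_subcover (f := fun g : G => left_translation g @` O) cC.
- exact: open_left_translation.
- by exists x; exists 1%g => //; rewrite /left_translation mulg1.
apply: (@negligibleS _ _ _ mu
    (\big[setU/set0]_(g <- D) (left_translation g @` O))).
  by move=> x /Dcov[g Dg Ogx]; rewrite -bigcup_seq; exists g.
by elim/big_ind : _ => // [|A B]; [exact: negligible_set0|exact: negligibleU].
Qed.

Lemma borel_left_translation (g : G) (A : set T) : measurable A ->
  measurable (left_translation g @` A : set T).
Proof.
move=> mA; rewrite left_translation_imageE -[X in measurable X]setTI.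
by apply: measurable_left_translation.
Qed.

End HaarFacts.

(** * Separating functionals by their values on an indicator function *)

Section NonCompact.
Variables (R : realType) (k : scalars) (G : topologicalGroupType).
Variable mu : {measure set (borelType G) -> \bar R}.
Hypothesis hmu : left_haar_measure mu.
Local Notation K := (scalar_field R k).
Local Notation T := (borelType G).
Local Open Scope quotient_scope.

Lemma indicator_L1 (A : set T) : measurable A -> (mu A < +oo)%E ->
  ((fun x => mk_scalar k (\1_A x) 0) : T -> K^o) \in L1_functions k mu.
Proof.
move=> mA Afin; apply/L1_functionsP; split.
  by under eq_fun do rewrite re_mk_scalar; exact: indic_integrable.
by under eq_fun do rewrite im_mk_scalar0; exact: integrable0.
Qed.

Variables (S : set G) (mS : measurable (S : set T)) (S_fin : (mu S < +oo)%E).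

Definition indicator_fun : L1fun k mu :=
  Sub ((fun x => mk_scalar k (\1_S x) 0) : T -> K^o) (indicator_L1 mS S_fin).

(** Translating the indicator of [S] by [h] gives that of [h^-1 S], where [phi] is constant; left
    invariance supplies the measure. *)
Lemma density_ball_translate (phi : T -> R) mphi phi1 (h : G) (a : R) :
  (forall x, (left_translation h^-1%g @` S) x -> phi x = a) ->
  evaluation (\pi_(L1 k mu) indicator_fun)
     (canonical_action hmu h (@density_ball R k G mu phi mphi phi1)) =
  mk_scalar k (a * fine (mu S)) 0.
Proof.
move=> phia; rewrite /evaluation canonical_actionE translateE /=.
rewrite density_functionalE// /density_pairing; congr (mk_scalar _ _ _).
  have mhS := borel_left_translation h^-1%g mS.
  have -> : mu S = mu (left_translation h^-1%g @` S).
    exact/esym/(haar_left_invariant hmu h^-1%g mS).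
  rewrite -Rintegral_cst//.
  rewrite [RHS]Rintegral_mkcond; apply: eq_Rintegral => x _.
  rewrite /= re_mk_scalar left_translation_imageE invgK.
  rewrite patchE indicE; have [Shx|nShx] := pselect (S (left_translation h x)).
    rewrite !mem_set// mulr1 phia// left_translation_imageE invgK.
    exact: Shx.
  by rewrite !memNset// mulr0.
transitivity (\int[mu]_(_ in [set: T]) (0 : R))%R.
  by apply: eq_Rintegral => x _; rewrite /= im_mk_scalar0 mulr0.
by rewrite Rintegral_cst// mul0r.
Qed.

Hypothesis S_gt0 : (0 < mu S)%E.

(** The value obtained from density [i / n] on a translate of [S]; these densities stay below 1, as
    the unit ball requires. *)
Definition level (n : nat) (i : 'I_n) : K :=
  mk_scalar k (i%:R / n%:R * fine (mu S)) 0.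

Lemma level_inj n : injective (@level n).
Proof.
move=> i j /(congr1 (@re_part R k)); rewrite !re_mk_scalar => ij.
have n0 : (n%:R : R) != 0 by rewrite pnatr_eq0; case: n i {j ij} => // -[].
have S0 : fine (mu S) != 0 by rewrite gt_eqF// fine_gt0// S_gt0.
have := mulIf (invr_neq0 n0) (mulIf S0 ij).
by move/eqP; rewrite eqr_nat => /eqP/val_inj.
Qed.

(** Excluding finitely many values gives an open set, and a functional with value [level j] lies in
    the [j]-th set only. *)
Definition level_set (n : nat) (j : 'I_n) : set (weak_star_ball k mu) :=
  [set l | forall i, i != j ->
    evaluation (\pi_(L1 k mu) indicator_fun) l <> level i].

Lemma level_cover n : (0 < n)%N -> finite_open_covering (range (@level_set n)).
Proof.
move=> n0; split.
- by apply: finite_image; exact: finite_finset.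
- move=> _ [j _ <-]; rewrite -closedC.
  rewrite (_ : ~` _ = \bigcup_(i in [set i | i != j])
      (evaluation (\pi_(L1 k mu) indicator_fun) @^-1` [set level i])).
    apply: closed_bigcup => [|i _]; first exact: finite_finset.
    move/continuous_closedP: (@evaluation_continuous R k G mu (\pi indicator_fun)).
    apply.
    apply: accessible_closed_set1; apply: hausdorff_accessible.
    exact: norm_hausdorff.
  apply/seteqP; split => [l /= /existsNP[i /not_implyP[ij /contrapT li]]|].
    by exists i.
  by move=> l [i ij li] /(_ i ij).
- apply/seteqP; split => // l _.
  have [[j lj]|nj] := pselect (exists j : 'I_n,
      evaluation (\pi_(L1 k mu) indicator_fun) l = level j).
    exists (level_set j); first by exists j.
    by move=> i ij; rewrite lj => /level_inj/esym; exact/eqP.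
  exists (level_set (Ordinal n0)); first by exists (Ordinal n0).
  by move=> i _ li; apply: nj; exists i.
Qed.

(* Every word [s] of length [m] over [n] letters is realised by the functional
   with density [s t / n] on the [t]-th translate, so that distinct words are
   told apart by the level cover. *)
Lemma covering_number_level (m n : nat) (E : set G) (h : nat -> G) :
  (forall t, (t < m)%N -> E (h t)) ->
  (forall t u, (t < u < m)%N ->
    left_translation (h t)^-1%g @` S `&` left_translation (h u)^-1%g @` S =
    set0) ->
  ((n ^ m)%:R%:E <=
     covering_number R (canonical_action (k := k) hmu) E
       (range (@level_set n)))%E.
Proof.
move=> Eh dis.
pose A (t : 'I_m) : set T := left_translation (h t)^-1%g @` S.
have mA t : measurable (A t) by exact: borel_left_translation.
have disA t u x : A t x -> A u x -> t = u.
  move=> Atx Aux; apply: val_inj; case: (ltngtP t u) => // tu.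
    by have := dis t u; rewrite tu ltn_ord => /(_ isT)/seteqP[/(_ x)] []; split.
  by have := dis u t; rewrite tu ltn_ord => /(_ isT)/seteqP[/(_ x)] []; split.
pose phi (s : {ffun 'I_m -> 'I_n}) (x : T) : R :=
  \sum_(t < m) (s t)%:R / n%:R * \1_(A t) x.
have phiE s t x : A t x -> phi s x = (s t)%:R / n%:R.
  move=> Atx; rewrite /phi (bigD1 t)//= indicE mem_set// mulr1.
  rewrite big1 ?addr0// => u ut.
  rewrite indicE memNset ?mulr0// => Aux.
  by move: ut; rewrite (disA _ _ _ Aux Atx) eqxx.
have mphi s : measurable_fun [set: T] (phi s).
  apply: measurable_sum => t; apply: measurable_funM => //.
(* The sets [A t] are disjoint, so at most one summand is nonzero at [x]. *)
have phi1 s x : `|phi s x| <= 1.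
  have [[t Atx]|nA] := pselect (exists t, A t x).
    rewrite (phiE _ _ _ Atx) ger0_norm ?divr_ge0//.
    have n0 : (0 < n)%N by case: (s t) => i; case: (n).
    by rewrite ler_pdivrMr ?ltr0n// mul1r ler_nat ltnW.
  rewrite /phi big1 ?normr0// => t _.
  by rewrite indicE memNset ?mulr0// => Atx; apply: nA; exists t.
apply: (@covering_number_ge R G _ _ m n E _ (fun t => h t)
  (fun s => density_ball k mu (mphi s) (phi1 s))) => [t|_ t s u [j _ <-]].
  exact: Eh.
have ev s' : evaluation (\pi_(L1 k mu) indicator_fun) (canonical_action hmu (h t)
    (density_ball k mu (mphi s') (phi1 s'))) = level (s' t).
  by apply: density_ball_translate => x; exact: phiE.
(* An image lying in [level_set j] forces the letter at [t] to be [j], so two words with images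
   there agree at [t]. *)
have lev s' : level_set j (canonical_action hmu (h t)
    (density_ball k mu (mphi s') (phi1 s'))) -> s' t = j.
  by move=> /(_ (s' t)) ls; apply/eqP; apply: contrapT => /negP/ls; apply.
by move=> /lev -> /lev ->.
Qed.

End NonCompact.

Lemma noncompact_infinite_entropy (R : realType) (k : scalars)
    (G : topologicalGroupType) (mu : {measure set (borelType G) -> \bar R})
    (hmu : left_haar_measure mu) :
  almost_connected G -> locally_compact [set: G] -> hausdorff_space G ->
  ~ compact [set: G] ->
  infinite_topological_entropy R (canonical_action (k := k) hmu).
Proof.
move=> acG lcG hG ncG.
have [S [gS nS SV]] := almost_connected_generating_nbhd acG lcG.
have [cS _] := gS.
have mS := borel_compact hG cS.
have S_fin := haar_compact_lty hmu cS.
exists S => //; apply: entropy_infinite => n n0.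
exists (range (@level_set R k G mu S mS S_fin n)).
  by apply: level_cover => //; exact: haar_nbhs_gt0.
move=> N; have [h [Sh dis]] := disjoint_translates N gS SV ncG.
exact: covering_number_level Sh dis.
Qed.

(** * Compactness of the dual ball *)

(** If [A] belongs to a finer proper filter, the preimage of its complement cannot be in [F], so
    that of [A] is. *)
Lemma fmap_ultra (T U : Type) (f : T -> U) (F : set_system T) :
  UltraFilter F -> UltraFilter (f @ F).
Proof.
move=> FU; split; first exact: fmap_proper_filter.
move=> H HP FH; apply/seteqP; split => // A HA.
have [//|FnA] := in_ultra_setVsetC (f @^-1` A) FU.
have /FH HnA : (f @ F) (~` A) by [].
exfalso; apply: (@filter_not_empty _ H); rewrite -(setICr A).
exact: (@filterI _ H _ _ _ HA HnA).
Qed.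

Section ScalarTopology.
Variables (R : realType) (k : scalars).
Local Notation K := (scalar_field R k).
Implicit Types (x y : K).

Lemma mk_scalar_gt0 (a : R) : (0 < mk_scalar k a 0) = (0 < a).
Proof. by rewrite /mk_scalar; case: k => //=; rewrite ltcE /= eqxx. Qed.

Lemma re_partB x y : re_part (x - y) = re_part x - re_part y.
Proof. by apply/eqP; rewrite eq_sym subr_eq -re_partD subrK. Qed.

Lemma im_partB x y : im_part (x - y) = im_part x - im_part y.
Proof. by apply/eqP; rewrite eq_sym subr_eq -im_partD subrK. Qed.

(** The norm takes values in [K], but positive elements of [K] have zero imaginary part, so real
    radii suffice. *)
Lemma scalar_cvgP (T : Type) (F : set_system T) (f : T -> K^o) (y : K^o) :
  Filter F -> f @ F --> y <->
  forall e : R, 0 < e -> \forall x \near F, modulus (y - f x : K) < e.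
Proof.
move=> FF; split=> [/cvgrPdist_lt fy e e0|fy].
  have ke0 : 0 < mk_scalar k e 0 by rewrite mk_scalar_gt0.
  have := fy _ ke0; apply: filterS => x.
  by rewrite norm_scalarE mk_scalar_lt.
apply/cvgrPdist_lt => _ /gt0_scalarE[e e0 ->].
have := fy _ e0; apply: filterS => x.
by rewrite norm_scalarE mk_scalar_lt.
Qed.

Lemma mk_scalar_continuous :
  continuous (fun p : R * R => mk_scalar k p.1 p.2 : K^o).
Proof.
move=> p; apply/scalar_cvgP => e e0.
have e20 : 0 < e / 2 by lra.
have c1 : \forall q \near p, `|p.1 - q.1| < e / 2.
  have : (fst : R * R -> R) @ p --> p.1 by exact: cvg_fst.
  by move=> /cvgrPdist_lt/(_ _ e20).
have c2 : \forall q \near p, `|p.2 - q.2| < e / 2.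
  have : (snd : R * R -> R) @ p --> p.2 by exact: cvg_snd.
  by move=> /cvgrPdist_lt/(_ _ e20).
apply: filterS2 c1 c2 => q h1 h2; apply: le_lt_trans (modulus_le _) _.
rewrite re_partB im_partB !re_mk_scalar [e]splitr; apply: ltr_leD => //.
have [im0|imE] := im_mk_scalarP R k; last by rewrite !imE ltW.
by rewrite !im0 subrr normr0 ltW.
Qed.

Lemma re_part_le x : `|re_part x| <= modulus x.
Proof.
rewrite -ler_sqr ?nnegrE ?modulus_ge0// sqr_modulus real_normK ?num_real//.
by rewrite lerDl sqr_ge0.
Qed.

Lemma im_part_le x : `|im_part x| <= modulus x.
Proof.
rewrite -ler_sqr ?nnegrE ?modulus_ge0// sqr_modulus real_normK ?num_real//.
by rewrite lerDr sqr_ge0.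
Qed.

(** The image of a compact square; over the reals the second coordinate is ignored and the interval
    remains. *)
Definition scalar_box (r : R) : set K^o :=
  [set mk_scalar k p.1 p.2 | p in `[- r, r] `*` `[- r, r]].

Lemma scalar_box_compact r : compact (scalar_box r).
Proof.
apply: continuous_compact.
  by apply: continuous_subspaceT; exact: mk_scalar_continuous.
by apply: compact_setX; exact: segment_compact.
Qed.

Lemma modulus_scalar_box r x : modulus x <= r -> scalar_box r x.
Proof.
move=> xr; exists (re_part x, im_part x).
  split; rewrite /= in_itv /= -ler_norml (le_trans _ xr) ?re_part_le//.
  exact: im_part_le.
apply: scalar_eqP; first by rewrite re_mk_scalar.
have [im0|imE] := im_mk_scalarP R k; last by rewrite imE.
by rewrite !im0.
Qed.

End ScalarTopology.

Section BanachAlaoglu.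
Variables (R : realType) (k : scalars) (G : topologicalGroupType).
Variable mu : {measure set (borelType G) -> \bar R}.
Local Notation K := (scalar_field R k).
Local Notation X := (weak_star_ball k mu).

Lemma L1_normZ (a : K) (f : L1 k mu) : L1_norm (a *: f) = modulus a * L1_norm f.
Proof.
elim/L1W: f => f; apply: EFin_inj.
have mf := K_integrable_modulus (L1funP f).
rewrite -L1_piZ EFinM !L1_normE -integralZl//.
by apply: eq_integral => x _; rewrite -EFinM -modulusM.
Qed.

Lemma L1_norm_ge0 (f : L1 k mu) : 0 <= L1_norm f.
Proof.
by apply: fine_ge0; apply: integral_ge0 => x _; rewrite lee_fin modulus_ge0.
Qed.

Lemma evaluation_linear (l : X) a f h :
  evaluation (a *: f + h) l = a * evaluation f l + evaluation h l.
Proof.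
by have [[lin _] _] := dual_ballP (l : dual_ball k mu); rewrite /evaluation lin.
Qed.

Lemma evaluationZ (l : X) a f : evaluation (a *: f) l = a * evaluation f l.
Proof.
have l0 : evaluation 0 l = 0.
  have := evaluation_linear l (-1) 0 0.
  by rewrite scaler0 addr0 mulN1r addNr.
by rewrite -[_ *: f]addr0 evaluation_linear l0 addr0.
Qed.

Lemma evaluationB (l : X) f h :
  evaluation (f - h) l = evaluation f l - evaluation h l.
Proof.
by rewrite -[- h]scaleN1r addrC evaluation_linear mulN1r addrC.
Qed.

(** The bound on the unit ball is applied to [f] divided by its norm plus [e]; the positive [e]
    avoids division by zero and is arbitrary. *)
Lemma evaluation_le (l : X) f : modulus (evaluation f l) <= L1_norm f.
Proof.
apply/ler_addgt0Pr => e e0; set r := L1_norm f + e.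
have r0 : 0 < r by rewrite /r ltr_wpDl ?L1_norm_ge0.
have [[lin _] le1] := dual_ballP (l : dual_ball k mu).
have ri0 : 0 <= r^-1 by rewrite invr_ge0 ltW.
have : ((modulus (evaluation (mk_scalar k r^-1 0 *: f) l))%:E <= 1%:E)%E.
  apply: le_trans le1; apply: ereal_sup_ubound.
  exists (mk_scalar k r^-1 0 *: f) => //=.
  rewrite L1_normZ modulus_mk_scalar// mulrC ler_pdivrMr// mul1r /r lerDl.
  exact: ltW.
rewrite lee_fin evaluationZ modulusM modulus_mk_scalar// mulrC.
by rewrite ler_pdivrMr// mul1r.
Qed.

(** Along an ultrafilter each evaluation stays in a compact box and converges. The pointwise limit
    inherits linearity and the norm bound. *)
Lemma weak_star_ball_compact : compact [set: X].
Proof.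
rewrite compact_ultra => F FU _.
have /choice[p pP] f : exists z : K^o, evaluation f @ F --> z.
  have := @scalar_box_compact R k (L1_norm f); rewrite compact_ultra.
  move=> /(_ (evaluation f @ F) (fmap_ultra _ FU)) [|z [_ zF]]; last by exists z.
  have boxF : \forall l \near F, scalar_box (L1_norm f) (evaluation f l).
    by apply: filterE => l; exact: (modulus_scalar_box (evaluation_le l f)).
  exact: boxF.
have p_lin : linear (p : L1 k mu -> K^o).
  move=> a f h; apply: (@cvg_unique K^o _ (evaluation (a *: f + h) @ F)) => //.
    exact: pP.
  have -> : evaluation (a *: f + h) =
      (fun l => a *: evaluation f l + evaluation h l : K^o).
    by apply/funext => l; exact: evaluation_linear.
  by apply: cvgD; [apply: cvgZr; exact: pP|exact: pP].
have p_le f : modulus (p f : K) <= L1_norm f.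
  apply/ler_addgt0Pr => e e0.
  have /scalar_cvgP/(_ e e0)/filter_ex[l le] := pP f.
  rewrite -(subrK (evaluation f l) (p f)).
  apply: le_trans (modulusD _ _) _; rewrite [leRHS]addrC.
  by apply: lerD; [exact: ltW|exact: evaluation_le].
have pB : in_dual_ball p.
  suff le1 : (dual_norm p <= 1)%E.
    by split=> //; split=> //; exact: le_lt_trans le1 (ltry 1).
  by apply: ge_ereal_sup => _ [f /= f1 <-]; rewrite lee_fin (le_trans (p_le f)).
exists (Sub p (asboolT pB) : dual_ball k mu); split=> //.
by apply/weak_star_cvgP => f; exact: pP.
Qed.

End BanachAlaoglu.

(** * Continuity of translation in L1 *)

Section TranslationContinuity.
Variables (R : realType) (G : topologicalGroupType).
Variable mu : {measure set (borelType G) -> \bar R}.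
Hypotheses (hmu : left_haar_measure mu) (hG : hausdorff_space G).
Local Notation T := (borelType G).
Local Notation integrable u := (mu.-integrable [set: T] (EFin \o u)).
Implicit Types (u v : T -> R) (g : G).

Definition L1_dist u v : R := (\int[mu]_x `|u x - v x|)%R.

Definition left_shift g u : T -> R := u \o (left_translation g : T -> T).

Lemma left_shift_integrable g u : integrable u -> integrable (left_shift g u).
Proof. exact: haar_integrable_translate. Qed.

Let integrable_add u v : integrable u -> integrable v ->
  integrable (fun x => u x + v x).
Proof. exact: integrableD. Qed.

Let integrable_dist u v : integrable u -> integrable v ->
  integrable (fun x => `|u x - v x|).
Proof.
move=> iu iv; apply: (@integrable_abse _ _ _ mu setT (EFin \o (fun x => u x - v x))).
exact: (integrableB measurableT iu iv).
Qed.

Lemma L1_dist_shift g u v : integrable u -> integrable v ->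
  L1_dist (left_shift g u) (left_shift g v) = L1_dist u v.
Proof.
move=> iu iv; rewrite /L1_dist /Rintegral; congr fine.
apply: (haar_integral_translate hmu g (u := fun x => `|u x - v x|%:E)) => [|x].
  by have /integrableP[] := integrable_dist iu iv.
by rewrite lee_fin.
Qed.

Lemma L1_distC u v : L1_dist u v = L1_dist v u.
Proof. by apply: eq_Rintegral => x _; rewrite distrC. Qed.

Lemma L1_dist_triangle u v w : integrable u -> integrable v -> integrable w ->
  L1_dist u w <= L1_dist u v + L1_dist v w.
Proof.
move=> iu iv iw; rewrite /L1_dist -RintegralD//; try exact: integrable_dist.
apply: le_Rintegral => //; first exact: integrable_dist.
  by apply: integrable_add; exact: integrable_dist.
by move=> x _; exact: ler_distD.
Qed.

Definition shift_continuous u : Prop :=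
  forall e : R, 0 < e ->
    \forall g \near (1%g : G), L1_dist (left_shift g u) u < e.

(** Shifts are isometries, so shifting [u] and [v] keeps them as close as before: an [e / 3]
    argument. *)
Lemma shift_continuous_approx u : integrable u ->
  (forall e : R, 0 < e -> exists v,
    [/\ integrable v, shift_continuous v & L1_dist u v < e]) ->
  shift_continuous u.
Proof.
move=> iu happ e e0; have e30 : 0 < e / 3 by lra.
have [v [iv sv uv]] := happ _ e30.
apply: filterS (sv _ e30) => g gv.
have igu := left_shift_integrable g iu; have igv := left_shift_integrable g iv.
have := L1_dist_triangle igu igv iu.
have := L1_dist_triangle igv iv iu.
rewrite L1_dist_shift// (L1_distC v u); lra.
Qed.

Lemma shift_continuous0 : shift_continuous (fun=> 0).
Proof.
move=> e e0; apply: filterE => g.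
suff -> : L1_dist (left_shift g (fun=> 0)) (fun=> 0) = 0 by [].
transitivity (\int[mu]_(_ in [set: T]) (0 : R))%R.
  by apply: eq_Rintegral => x _; rewrite /left_shift /= subrr normr0.
by rewrite Rintegral_cst// mul0r.
Qed.

Lemma shift_continuousD u v : integrable u -> integrable v ->
  shift_continuous u -> shift_continuous v ->
  shift_continuous (fun x => u x + v x).
Proof.
move=> iu iv su sv e e0; have e20 : 0 < e / 2 by lra.
apply: filterS2 (su _ e20) (sv _ e20) => g gu gv.
have igu := left_shift_integrable g iu; have igv := left_shift_integrable g iv.
rewrite [e]splitr; apply: le_lt_trans (ltrD gu gv).
rewrite /L1_dist -RintegralD//; try exact: integrable_dist.
apply: le_Rintegral => //.
- apply: integrable_dist; last exact: integrable_add.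
  by apply: left_shift_integrable; exact: integrable_add.
- by apply: integrable_add; exact: integrable_dist.
- move=> x _; rewrite /left_shift /= opprD addrACA; exact: ler_normD.
Qed.

Lemma shift_continuousZ c u : integrable u -> shift_continuous u ->
  shift_continuous (fun x => c * u x).
Proof.
move=> iu su e e0.
(* Adding 1 covers the case where [c] is 0. *)
have c0 : 0 < `|c| + 1 by rewrite ltr_wpDl.
apply: filterS (su _ (divr_gt0 e0 c0)) => g.
rewrite ltr_pdivlMr// => gu.
suff -> : L1_dist (left_shift g (fun x => c * u x)) (fun x => c * u x) =
    `|c| * L1_dist (left_shift g u) u.
  apply: le_lt_trans gu; rewrite mulrC ler_wpM2l ?lerDl//.
  by apply: Rintegral_ge0.
have igu := left_shift_integrable g iu.
rewrite -[RHS]RintegralZl//; last exact: integrable_dist.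
by apply: eq_Rintegral => x _; rewrite /left_shift /= -mulrBr normrM.
Qed.

Lemma Rint_indic (A : set T) : measurable A ->
  (\int[mu]_x \1_A x)%R = fine (mu A).
Proof. by move=> mA; rewrite /Rintegral integral_indic// setIT. Qed.

(* If a compact subset [C] of [O] nearly exhausts [O] and [gC] stays inside [O],
   then [O] and its translate by [g^-1] both contain [C] and have the same
   measure, so they nearly agree. *)
Lemma shift_continuous_open (O : set G) : open O -> (mu O < +oo)%E ->
  shift_continuous (\1_O : T -> R).
Proof.
move=> oO Ofin e e0; have e20 : 0 < e / 2 by lra.
have mO := borel_open oO.
have Ofn : mu O \is a fin_num by rewrite ge0_fin_numE.
have [C [cC CO] OC] : exists2 C : set G, compact C /\ C `<=` O &
    (mu O - (e / 2)%:E < mu C)%E.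
  have : (mu O - (e / 2)%:E < mu O)%E.
    by rewrite -(fineK Ofn) -EFinB lte_fin ltrBlDr ltrDl.
  rewrite {2}(haar_inner_regular hmu oO) => /ereal_sup_gt[_ [C cC <-] h].
  by exists C.
have mC := borel_compact hG cC.
have Cfn : mu C \is a fin_num by rewrite ge0_fin_numE// (haar_compact_lty hmu cC).
(* Compactness of [C] makes one neighbourhood of 1 work for all its points. *)
have near1 : \forall g \near (1%g : G), left_translation g @` C `<=` O.
  have /compact_near_coveringP cov := cC.
  have : \forall g \near (1%g : G), C `<=` [set x | O (g * x)%g].
    apply: cov => x Cx.
    have : {for (x, 1%g : G), continuous (fun p : G * G => p.2 * p.1)%g}.
      apply: (@continuous_comp _ _ _ (fun p : G * G => (p.2, p.1))
        (fun p : G * G => p.1 * p.2)%g); last exact: mulg_continuous.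
      by apply: cvg_pair; [exact: cvg_snd|exact: cvg_fst].
    apply; apply: open_nbhs_nbhs; split=> //=.
    by rewrite mul1g; exact: CO.
  by apply: filterS => g gC _ [x Cx <-]; exact: gC.
apply: filterS near1 => g gCO.
(* This is [g^-1 O], whose indicator is the shifted indicator of [O]. *)
pose gO : set T := left_translation g @^-1` O.
have gOE : gO = left_translation (g^-1)%g @` O by
  by rewrite left_translation_imageE invgK.
have mgO : measurable gO by rewrite gOE; exact: borel_left_translation.
have mu_gO : mu gO = mu O by rewrite gOE; exact: (haar_left_invariant hmu _ mO).
have CgO : C `<=` gO by move=> x Cx; apply: gCO; exists x.
have diff (A : set T) : measurable A -> mu A = mu O -> C `<=` A ->
    fine (mu (A `\` C)) < e / 2.
  move=> mA AO CA; have Afin : (mu A < +oo)%E by rewrite AO.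
  have Afn : mu A \is a fin_num by rewrite AO.
  have fAO : fine (mu A) = fine (mu O) by rewrite AO.
  rewrite measureD// (_ : A `&` C = C); last exact/setIidr.
  rewrite fineB// fAO; move: OC.
  by rewrite -(fineK Ofn) -(fineK Cfn) -EFinB lte_fin /=; lra.
have fin_diff (A : set T) : measurable A -> mu A = mu O -> (mu (A `\` C) < +oo)%E.
  move=> mA AO; apply: le_lt_trans Ofin; rewrite -AO.
  by apply: le_measure; rewrite ?inE//; exact: measurableD.
have := ltrD (diff _ mO erefl CO) (diff _ mgO mu_gO CgO).
rewrite -splitr; apply: le_lt_trans.
have mOC : measurable (O `\` C : set T) by exact: measurableD.
have mgOC : measurable (gO `\` C : set T) by exact: measurableD.
have iOC := indic_integrable mOC (fin_diff _ mO erefl).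
have igOC := indic_integrable mgOC (fin_diff _ mgO mu_gO).
rewrite -!Rint_indic// -RintegralD//.
apply: le_Rintegral => //.
- apply: integrable_dist; last exact: indic_integrable.
  by apply: left_shift_integrable; exact: indic_integrable.
- exact: integrable_add.
(* On [C] both indicators are 1; elsewhere their difference is at most the sum of the indicators of
   the two remainders. *)
- move=> x _; rewrite /left_shift /= !indicE !in_setD.
  rewrite -[left_translation g x \in O]/(x \in gO).
  have [xC|_] := boolP (x \in C).
    rewrite (mem_set (CO _ (set_mem xC))) (mem_set (CgO _ (set_mem xC))).
    by rewrite subrr normr0 addr0.
  case: (_ \in O); case: (_ \in gO);
    rewrite /= ?subrr ?subr0 ?sub0r ?normrN ?normr0 ?normr1;
    lra.
Qed.

(** Outer regularity gives an open set containing [A] of measure less than [mu A + e], which reduces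
    to the open case. *)
Lemma shift_continuous_indic (A : set T) : measurable A -> (mu A < +oo)%E ->
  shift_continuous (\1_A : T -> R).
Proof.
move=> mA Afin; apply: shift_continuous_approx => [|e e0].
  exact: indic_integrable.
have Afn : mu A \is a fin_num by rewrite ge0_fin_numE.
have : (mu A < mu A + e%:E)%E by rewrite -(fineK Afn) -EFinD lte_fin ltrDl.
rewrite {1}(haar_outer_regular hmu mA) => /ereal_inf_lt[_ [ O [oO AO] <-] Oe].
have mO := borel_open oO.
have Ofin : (mu O < +oo)%E by apply: (lt_trans Oe); rewrite -(fineK Afn) ltry.
have Ofn : mu O \is a fin_num by rewrite ge0_fin_numE.
exists (\1_O : T -> R); split; [exact: indic_integrable|exact: shift_continuous_open|].
have mOA : measurable (O `\` A : set T) by exact: measurableD.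
have -> : L1_dist (\1_A : T -> R) \1_O = fine (mu (O `\` A)).
  rewrite -Rint_indic//; apply: eq_Rintegral => x _; rewrite !indicE in_setD.
  have [xA|_] := boolP (x \in A).
    by rewrite (mem_set (AO _ (set_mem xA))) subrr normr0.
  by case: (x \in O); rewrite /= sub0r normrN ?normr0 ?normr1.
rewrite measureD// (_ : O `&` A = A); last exact/setIidr.
rewrite fineB//; move: Oe.
by rewrite -(fineK Ofn) -(fineK Afn) -EFinD lte_fin /=; lra.
Qed.

Lemma shift_continuous_sfun (f : {sfun T >-> R}) : integrable (f : T -> R) ->
  shift_continuous f.
Proof.
move=> intf.
have level_ok (y : R) : integrable (fun x => y * \1_(f @^-1` [set y]) x) /\
    shift_continuous (fun x => y * \1_(f @^-1` [set y]) x).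
  (* The zero level may have infinite measure but contributes nothing. For [y] nonzero the indicator
     is dominated by [f / y], so the level has finite measure. *)
  have [->|y0] := eqVneq y 0.
    rewrite (_ : (fun x => _) = fun=> 0); last by apply/funext => x; rewrite mul0r.
    by split; [exact: integrable0|exact: shift_continuous0].
  have mA : measurable (f @^-1` [set y] : set T) by [].
  have iA : integrable (\1_(f @^-1` [set y]) : T -> R).
    apply: (le_integrable measurableT _ _ (integrableZl measurableT y^-1 intf)).
      exact/measurable_EFinP.
    move=> x _ /=; rewrite lee_fin indicE.
    have [/set_mem /= ->|_] := boolP (x \in _); last by rewrite normr0.
    by rewrite mulVf// normr1.
  have Afin : (mu (f @^-1` [set y]) < +oo)%E.
    have /integrableP[_] := iA.
    under eq_integral do rewrite gee0_abs ?lee_fin//.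
    by rewrite integral_indic// setIT.
  split; first exact: (integrableZl measurableT y iA).
  by apply: shift_continuousZ => //; exact: shift_continuous_indic.
pose level_sum (s : seq R) (x : T) : R :=
  \sum_(y <- s) y * \1_(f @^-1` [set y]) x.
rewrite (_ : f = level_sum (fset_set (range f)) :> (T -> R)); last first.
  by apply/funext => x; rewrite fimfunE fsbig_finite.
suff : forall s, integrable (level_sum s) /\ shift_continuous (level_sum s).
  by move=> /(_ (fset_set (range f)))[].
rewrite /level_sum; elim=> [|y s [int_s sc_s]].
  under eq_fun do rewrite big_nil.
  by split; [exact: integrable0|exact: shift_continuous0].
have [iy sy] := level_ok y.
under eq_fun do rewrite big_cons.
by split; [exact: integrable_add|exact: shift_continuousD].
Qed.

Lemma integrable_shift_continuous u : integrable u -> shift_continuous u.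
Proof.
move=> iu; apply: shift_continuous_approx => // e e0.
have [f [fi _ fu]] := approximation_sfun_integrable measurableT iu.
have /fine_cvgP[_ /cvgrPdist_lt/(_ _ e0)/filter_ex[n]] := fu.
rewrite sub0r normrN => un; exists (f n); split => //.
  exact: shift_continuous_sfun.
by apply: le_lt_trans un; exact: ler_norm.
Qed.

End TranslationContinuity.

(** * Compact groups *)

Section JointContinuity.
Variables (R : realType) (k : scalars) (G : topologicalGroupType).
Variable mu : {measure set (borelType G) -> \bar R}.
Hypotheses (hmu : left_haar_measure mu) (hG : hausdorff_space G).
Local Notation K := (scalar_field R k).
Local Notation T := (borelType G).
Local Notation X := (weak_star_ball k mu).
Local Open Scope quotient_scope.

Lemma translate_comp (g h : G) (f : L1 k mu) :
  translate hmu g (translate hmu h f) = translate hmu (h * g)%g f.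
Proof.
elim/L1W: f => f; rewrite !translateE.
apply/L1_eqP/aeW => x /=; congr (val f _).
by rewrite /left_translation mulgA.
Qed.

Lemma translateB (g : G) (f h : L1 k mu) :
  translate hmu g (f - h) = translate hmu g f - translate hmu g h.
Proof. by rewrite addrC -scaleN1r translate_linear scaleN1r addrC. Qed.

Lemma translate_near1 (f : L1 k mu) (e : R) : 0 < e ->
  \forall g \near (1%g : G), L1_norm (translate hmu g f - f) < e.
Proof.
move=> e0; elim/L1W: f => f; have e20 : 0 < e / 2 by lra.
have [fr fi] := L1funP f.
have sr := integrable_shift_continuous hmu hG fr e20.
have si := integrable_shift_continuous hmu hG fi e20.
apply: filterS2 sr si => g gr gi.
rewrite [e]splitr; apply: le_lt_trans (ltrD gr gi).
have -> : translate hmu g (\pi_(L1 k mu) f) - \pi_(L1 k mu) f =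
    \pi_(L1 k mu) (translate_fun hmu g f - f).
  rewrite translateE addrC -scaleN1r -L1_piZ -L1_piD.
  by congr (\pi _); rewrite scaleN1r addrC.
have igr := left_shift_integrable hmu g fr.
have igi := left_shift_integrable hmu g fi.
have ir := integrable_abse (integrableB measurableT igr fr).
have ii := integrable_abse (integrableB measurableT igi fi).
have mod_le := integrableD measurableT ir ii.
have im := K_integrable_modulus (L1funP (translate_fun hmu g f - f)).
have -> : L1_norm (\pi_(L1 k mu) (translate_fun hmu g f - f)) =
    (\int[mu]_x modulus (val (translate_fun hmu g f - f) x))%R.
  by rewrite /Rintegral -L1_normE.
rewrite /L1_dist -RintegralD//; apply: le_Rintegral => // x _.
by apply: le_trans (modulus_le _) _; rewrite re_partB im_partB.
Qed.

(** Reduction to continuity at 1: [g * h^-1] tends to 1, and the isometry [translate hmu h] turns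
    its displacement of [f] into the required difference. *)
Lemma translate_continuous (f : L1 k mu) (g : G) (e : R) : 0 < e ->
  \forall h \near g, L1_norm (translate hmu g f - translate hmu h f) < e.
Proof.
move=> e0.
have cg : {for g, continuous (fun h : G => (g * h^-1)%g)}.
  apply: (@continuous_comp _ _ _ (fun h : G => (g, h^-1)%g)
    (fun p : G * G => (p.1 * p.2)%g)); last exact: mulg_continuous.
  by apply: cvg_pair; [exact: cvg_cst|exact: invg_continuous].
have : nbhs (g * g^-1)%g (fun h => L1_norm (translate hmu h f - f) < e).
  by rewrite mulgV; exact: translate_near1.
move=> /cg near_g.
have {near_g} : \forall h \near g,
    L1_norm (translate hmu (g * h^-1)%g f - f) < e.
  exact: near_g.
apply: filterS => h.
by rewrite -(L1_norm_translate hmu h) translateB translate_comp mulgVK.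
Qed.

(** With [T_g] for translation by [g], the difference splits as
    [(l - l')(T_g f) + l'(T_g f - T_h f)]. The first term is small by weak-* closeness, the second
    uniformly in [l'] since the ball bounds it by an [L^1] distance. *)
Lemma canonical_action_continuous :
  continuous (fun p : G * X => canonical_action hmu p.1 p.2).
Proof.
move=> [g l]; apply/weak_star_cvgP => f; apply/scalar_cvgP => e e0.
have e20 : 0 < e / 2 by lra.
have evE h (l' : X) : evaluation f (canonical_action hmu h l') =
  evaluation (translate hmu h f) l' by [].
have c1 : \forall p \near (g, l),
    L1_norm (translate hmu g f - translate hmu p.1 f) < e / 2.
  have : (fst : G * X -> G) @ (g, l) --> g by exact: cvg_fst.
  by move=> c; exact: (c _ (translate_continuous f g e20)).
have c2 : \forall p \near (g, l), modulus (evaluation (translate hmu g f) l -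
    evaluation (translate hmu g f) p.2 : K) < e / 2.
  have : (snd : G * X -> X) @ (g, l) --> l by exact: cvg_snd.
  move=> c; have /scalar_cvgP/(_ _ e20) :=
    @evaluation_continuous R k G mu (translate hmu g f) l.
  exact: c.
apply: filterS2 c1 c2 => -[h l'] /= hh hl'.
rewrite !evE [e]splitr.
rewrite -(subrK (evaluation (translate hmu g f) l')
  (evaluation (translate hmu g f) l)).
rewrite -addrA -evaluationB (le_lt_trans (modulusD _ _))//.
by apply: ltrD => //; apply: le_lt_trans hh; exact: evaluation_le.
Qed.

(** Compactness is used twice: that of [G] gives each [l] one neighbourhood fit for all [g], as in
    the tube lemma, and that of the ball leaves finitely many of these. *)
Lemma compact_uniform_refinement (U : set (set X)) :
  compact [set: G] -> finite_open_covering U ->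
  exists2 V, finite_open_covering V &
    refines_along (canonical_action hmu) [set: G] U V.
Proof.
move=> cG [_ Uo Ucov].
have loc (l : X) : exists W, [/\ open W, W l & forall g, exists2 A, U A &
    canonical_action hmu g @` W `<=` A].
  have /choice[QW QWP] (g : G) : exists QW : set G * set X,
      [/\ open QW.1, QW.1 g, nbhs l QW.2 & exists2 A, U A &
        forall h l', QW.1 h -> QW.2 l' -> A (canonical_action hmu h l')].
    have : [set: X] (canonical_action hmu g l) by [].
    rewrite -Ucov => -[A UA Agl].
    have nA : nbhs (canonical_action hmu g l) A.
      by apply: open_nbhs_nbhs; split => //; exact: Uo.
    have [[Q W] /= [nQ nW] QWA] := @canonical_action_continuous (g, l) A nA.
    exists (Q^°, W); split => //=; first exact: open_interior.
    exists A => // h l' Qh Wl'; apply: (QWA (h, l')); split => //=.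
    exact: interior_subset Qh.
  have [g|g _|D Dcov] := compact_finite_subcover (f := fun g => (QW g).1) cG.
  - by have [] := QWP g.
  - by exists g; have [] := QWP g.
  pose W := \bigcap_(g in [set` D]) (QW g).2.
  exists W^°; split.
  - exact: open_interior.
  - by apply: filter_bigI => g _; have [] := QWP g.
  - move=> h; have [g Dg Qh] := Dcov h I; have [_ _ _ [A UA hA]] := QWP g.
    exists A => // _ [l' /interior_subset Wl' <-]; apply: hA => //.
    exact: Wl'.
have [W WP] := choice loc.
have [l|l _|D Dcov] := compact_finite_subcover (f := W)
  (@weak_star_ball_compact R k G mu).
- by have [] := WP l.
- by exists l; have [] := WP l.
exists (W @` [set` D]); last first.
  by move=> g _ _ [l _ <-]; have [_ _] := WP l; exact.
split.
- by apply: finite_image; exact: finite_fset.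
- by move=> _ [l _ <-]; have [] := WP l.
- apply/seteqP; split => // l _; have [l' Dl' Wl] := Dcov l I.
  by exists (W l') => //; exists l'.
Qed.

(** A refinement along all of [G] bounds the covering numbers of every [S^n] at once, for any
    generating set [S]. *)
Lemma compact_finite_entropy : compact [set: G] ->
  ~ infinite_topological_entropy R (canonical_action (k := k) hmu).
Proof.
move=> cG [S _ S_oo].
suff : (entropy R (canonical_action (k := k) hmu) S <= 0)%E by rewrite S_oo.
apply: entropy_le0 => U covU.
have [V covV UV] := compact_uniform_refinement cG covU.
exists #|` fset_set V|%fset => n; apply: ereal_inf_lbound.
by exists V => //; split => // g B _; exact: UV.
Qed.

End JointContinuity.

Theorem corollary5p9 (R : realType) (k : scalars) (G : topologicalGroupType)
    (mu : {measure set (borelType G) -> \bar R}) (hmu : left_haar_measure mu) :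
  almost_connected G -> locally_compact [set: G] -> hausdorff_space G ->
  ~ compact [set: G] <->
  infinite_topological_entropy R (canonical_action (k := k) hmu).
Proof.
move=> acG lcG hG; split; first exact: noncompact_infinite_entropy.
by move=> inf cG; exact: (compact_finite_entropy hG cG inf).
Qed.
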